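(* Let $\Bbbk$ be an algebraically closed field of characteristic $2$, and let $X_1\subset\mathbb{P}^3$ be the Kummer quartic surface associated with a smooth curve of genus $2$ and $2$-rank $1$. Then $\mathrm{Bit}(X_1)$ is of bidegree $(2,4)$ in $G_1(\mathbb{P}^3)$. It consists of two tropes (that is, the two $\beta$-planes of lines contained in the two trope planes) and two quadric surfaces; one of the latter is a smooth quadric $S(\sigma_1)$, and the other is a quadric cone $S(\sigma_2)$.
   Context: $G_1(\mathbb{P}^3)$ is the Grassmannian of lines in $\mathbb{P}^3$, embedded in $\mathbb{P}^5$ by Plücker. A congruence of lines is a surface $F\subset G_1(\mathbb{P}^3)$. Its bidegree is $(m,n)$, where the order $m$ is the number of lines of $F$ through a general point of $\mathbb{P}^3$ and the class $n$ is the number of lines of $F$ contained in a general plane. A line $\ell$ is a bitangent line of a normal surface $X\subset\mathbb{P}^3$ if either $\ell\subset X$, or $X$ cuts out on $\ell$ a divisor $2a+2b+D'$ with $D'$ effective ($a=b$ allowed). $\mathrm{Bit}(X)\subset G_1(\mathbb{P}^3)$ is the variety of bitangent lines of $X$. The Kummer quartic surface associated with a smooth genus $2$ curve $C$ is the quotient $J(C)/(\iota)$ of the Jacobian by the negation involution, embedded in $\mathbb{P}^3$ as a quartic surface. The curve $C$ has $2$-rank $1$ if $J(C)$ has exactly two $2$-torsion points. In that case the surface is given in suitable coordinates by $$X_1=V(\beta^2x^4+\alpha^2x^2z^2+x^2zw+xyz^2+y^2w^2+z^4),\qquad \alpha,\beta\in\Bbbk,\ \beta\neq 0.$$ A trope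 is a plane cutting the surface along a double conic; here the tropes are $V(x)$ and $V(z)$. The maps $$\sigma_1:[x,y,z,w]\mapsto[xz^2,yz^2,\beta x^2z,\beta x^2w],\qquad \sigma_2:[x,y,z,w]\mapsto[x^2z,x^2w,xz^2,yz^2]$$ are Cremona involutions preserving $X_1$ and restricting to birational involutions of $X_1$. For a birational involution $\sigma$ of a quartic surface $X$, $S(\sigma)\subset G_1(\mathbb{P}^3)$ is the closure of the set of lines $\langle x,\sigma(x)\rangle$ for general $x\in X$. *)

(* Defs.v *)
From HB Require Import structures.
From mathcomp Require Import all_boot all_order all_algebra.
From mathcomp Require Import mpoly ring.

Set Implicit Arguments.
Unset Strict Implicit.
Unset Printing Implicit Defensive.

Import GRing.Theory.
Local Open Scope ring_scope.

(* r and n are projective dimensions: r-planes in P^n(k). *)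
Definition gr (k : fieldType) (r n : nat) :=
  {U : {vspace 'rV[k]_n.+1} | \dim U == r.+1}.

Notation proj k n := (gr k 0 n).
Notation line k := (gr k 1 3).
(* A plane of P^3 is a point of the dual space: the class of a nonzero linear
   form v |-> \sum_i h 0 i * v 0 i. *)
Notation plane k := (gr k 0 3).

Lemma dim_pt (k : fieldType) n (v : 'rV[k]_n.+1) :
  v != 0 -> \dim <[v]> == 1%N.
Proof. by move=> v0; rewrite dim_vline v0. Qed.

Definition pt (k : fieldType) n (v : 'rV[k]_n.+1) (v0 : v != 0) : proj k n :=
  exist _ <[v]>%VS (dim_pt v0).

Definition ev (k : fieldType) n (f : {mpoly k[n]}) (v : 'rV[k]_n) : k :=
  f.@[fun i => v 0 i].

Definition vanishes (k : fieldType) n (f : {mpoly k[n.+1]}) (p : proj k n) :=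
  forall v, v \in val p -> ev f v = 0.

Definition zclosed (k : fieldType) n (Z : proj k n -> Prop) : Prop :=
  exists I : {mpoly k[n.+1]} -> Prop,
    (forall f, I f -> exists d, f \is d.-homog) /\
    (forall p, Z p <-> (forall f, I f -> vanishes f p)).

Definition zclosure (k : fieldType) n (A : proj k n -> Prop) (p : proj k n) :=
  forall Z, zclosed Z -> (forall q, A q -> Z q) -> Z p.

Definition open_dense_in (k : fieldType) n (X U : proj k n -> Prop) : Prop :=
  (exists2 Z, zclosed Z & forall p, U p <-> X p /\ ~ Z p) /\
  (forall p, X p -> zclosure U p).

(* P^n being irreducible, dense means nonempty here. *)
Definition generally (k : fieldType) n (P : proj k n -> Prop) : Prop :=
  exists2 U, open_dense_in (fun=> True) U & forall p, U p -> P p.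

Definition pluecker_index : seq ('I_4 * 'I_4) :=
  let o (i : nat) (h : (i < 4)%N) : 'I_4 := Ordinal h in
  [:: (o 0 isT, o 1 isT); (o 0 isT, o 2 isT); (o 0 isT, o 3 isT);
      (o 1 isT, o 2 isT); (o 1 isT, o 3 isT); (o 2 isT, o 3 isT)]%N.

Definition wedge (k : fieldType) (u v : 'rV[k]_4) : 'rV[k]_6 :=
  \row_i (let: (a, b) := nth (0, 0) pluecker_index i in
          u 0 a * v 0 b - u 0 b * v 0 a).

Lemma wedge0_minor (k : fieldType) (u v : 'rV[k]_4) :
  wedge u v = 0 -> forall a b, u 0 a * v 0 b = u 0 b * v 0 a.
Proof.
move=> w0.
have ltm (a b : 'I_4) : (a < b)%N -> u 0 a * v 0 b = u 0 b * v 0 a.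
  move=> ab; apply/eqP; rewrite -subr_eq0; apply/eqP.
  have m_in : (a, b) \in pluecker_index.
    by case: a b ab => [[|[|[|[|]]]] //= ?] [[|[|[|[|]]]] //= ?].
  have lt6 : (index (a, b) pluecker_index < 6)%N by rewrite index_mem.
  move/matrixP/(_ 0 (Ordinal lt6)): w0.
  by rewrite !mxE /= nth_index.
move=> a b; case: (ltngtP a b) => [/ltm //|/ltm /esym //|/val_inj -> //].
Qed.

Lemma wedge_neq0 (k : fieldType) (u v : 'rV[k]_4) :
  free [:: u; v] -> wedge u v != 0.
Proof.
rewrite free_cons span_seq1 seq1_free => /andP[uv v0].
apply: contra uv => /eqP/wedge0_minor w0.
have [j vj] : exists j, v 0 j != 0 by apply/rV0Pn.
apply/vlineP; exists (u 0 j / v 0 j); apply/rowP => i.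
by rewrite !mxE mulrAC -w0 mulfK.
Qed.

Lemma line_basis (k : fieldType) (l : line k) :
  basis_of (val l) [:: (vbasis (val l))`_0; (vbasis (val l))`_1].
Proof.
have := vbasisP (val l); have : size (vbasis (val l)) = 2%N.
  by rewrite size_tuple (eqP (valP l)).
by case: (vbasis (val l)) => [[|a [|b [|]]] //= _].
Qed.

Definition pluecker (k : fieldType) (l : line k) : proj k 5 :=
  pt (wedge_neq0 (basis_free (line_basis l))).

(* The Pluecker point may be computed from any two vectors spanning the line. *)
Lemma plueckerE (k : fieldType) (l : line k) (u v : 'rV[k]_4) :
  val l = <<[:: u; v]>>%VS -> val (pluecker l) = <[wedge u v]>%VS.
Proof.
move=> luv; rewrite /pluecker /=.
have := line_basis l; set a := _`_0; set b := _`_1 => ab.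
have uvb : basis_of (val l) [:: u; v].
  by rewrite basisEdim luv subvv -luv (eqP (valP l)).
have wneq0 := wedge_neq0 (basis_free uvb).
have inuv c : c \in val l -> exists s t, c = s *: u + t *: v.
  rewrite luv span_cons span_seq1 => /memv_addP[_ /vlineP[s ->]].
  by case=> _ /vlineP[t ->] ->; exists s, t.
have [s [t Ea]] := inuv a (basis_mem ab (mem_head _ _)).
have [s' [t' Eb]] : exists s t, b = s *: u + t *: v.
  by apply: inuv; apply: (basis_mem ab); rewrite !inE eqxx orbT.
have E : wedge a b = (s * t' - t * s') *: wedge u v.
  apply/rowP => i; rewrite !mxE; case: nth => c d; rewrite Ea Eb !mxE.
  by ring.
have d0 : s * t' - t * s' != 0.
  have := wedge_neq0 (basis_free ab); rewrite E; apply: contraNneq => ->.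
  by rewrite scale0r.
apply/eqP; rewrite E eqEdim !dim_vline wneq0 scaler_eq0 negb_or d0 wneq0 andbT.
by rewrite -memvE memvZ ?memv_line.
Qed.

Definition line_in_plane (k : fieldType) (H : plane k) (l : line k) : Prop :=
  forall h v, h \in val H -> v \in val l -> \sum_i h 0 i * v 0 i = 0.

Definition has_bidegree (k : fieldType) (B : line k -> Prop) (m n : nat) :=
  generally (fun p : proj k 3 => exists s : seq (line k),
    [/\ uniq s, size s = m &
        forall l, l \in s <-> B l /\ (val p <= val l)%VS]) /\
  generally (fun H : plane k => exists s : seq (line k),
    [/\ uniq s, size s = n & forall l, l \in s <-> B l /\ line_in_plane H l]).

(* This is F(u + T v), a polynomial in T: if u spans the point p of the line <u, v>,
   its order of vanishing at T = 0 is the multiplicity at p of the divisor cut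
   out by V(F) on that line. *)
Definition restr (k : fieldType) (F : {mpoly k[4]}) (u v : 'rV[k]_4) :
    {poly k} :=
  mmap polyC (fun i => (u 0 i)%:P + (v 0 i) *: 'X) F.

Definition mult_ge (k : fieldType) (F : {mpoly k[4]}) (l : line k)
    (p : proj k 3) (m : nat) : Prop :=
  forall u v, val p = <[u]>%VS -> val l = <<[:: u; v]>>%VS ->
    'X^m %| restr F u v.

(* The second alternative says that the divisor cut out on l is at least
   2a + 2b, i.e. equal to 2a + 2b + D' with D' effective. *)
Definition bitangent (k : fieldType) (F : {mpoly k[4]}) (l : line k) : Prop :=
  (forall v, v \in val l -> ev F v = 0) \/
  (exists a b : proj k 3,
    [/\ (val a <= val l)%VS, (val b <= val l)%VS &
        forall p : proj k 3, (val p <= val l)%VS ->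
          mult_ge F l p (2 * (p == a) + 2 * (p == b))%N]).

(* The rows of N are a basis of the plane, so the 3-variable polynomial is the
   equation of the plane section in homogeneous coordinates of the plane. *)
Definition trope (k : fieldType) (F : {mpoly k[4]}) (H : plane k) : Prop :=
  exists (N : 'M[k]_(3, 4)) (c : {mpoly k[3]}),
    [/\ row_free N,
        forall h i, h \in val H -> \sum_j h 0 j * N i j = 0,
        c \is 2.-homog, c != 0 &
        comp_mpoly [tuple \sum_(i < 3) N i j *: 'X_i | j < 4] F = c ^+ 2].

(* A rational self-map of P^3, given by four forms of the same degree. *)
Definition ratmap (k : fieldType) := 'I_4 -> {mpoly k[4]}.

Definition rapply (k : fieldType) (s : ratmap k) (v : 'rV[k]_4) : 'rV[k]_4 :=
  \row_i ev (s i) v.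

(* As l is two-dimensional, this implies that s is defined at p and s p <> p. *)
Definition joins (k : fieldType) (s : ratmap k) (p : proj k 3) (l : line k) :=
  exists2 v, val p = <[v]>%VS & val l = <<[:: v; rapply s v]>>%VS.

Definition pl_image (k : fieldType) (A : line k -> Prop) (P : proj k 5) :=
  exists2 l, A l & P = pluecker l.

(* The closure of the set of lines <p, s p> for general p in X: the closure is
   taken with p in an arbitrarily small dense open subset U of X. *)
Definition Ssurf (k : fieldType) (X : proj k 3 -> Prop) (s : ratmap k)
    (L : line k) : Prop :=
  forall U, open_dense_in X U ->
    zclosure (pl_image (fun l => exists2 p, U p & joins s p l)) (pluecker L).

(* Jacobian criterion for the projective hypersurface V(c). *)
Definition nonsingular (k : fieldType) n (c : {mpoly k[n]}) : Prop :=
  forall u : 'rV[k]_n, u != 0 -> ev c u = 0 -> exists i, ev (c^`M(i)) u != 0.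

(* A smooth quadric in the P^3 spanned by the rows of M. *)
Definition smooth_quadric_surface (k : fieldType) (Z : proj k 5 -> Prop) :=
  exists (M : 'M[k]_(4, 6)) (c : {mpoly k[4]}),
    [/\ row_free M, c \is 2.-homog, nonsingular c &
        forall P, Z P <->
          exists2 u : 'rV[k]_4, val P = <[u *m M]>%VS & ev c u = 0].

(* The cone with vertex e over a smooth conic in the plane spanned by the rows
   of N. *)
Definition quadric_cone (k : fieldType) (Z : proj k 5 -> Prop) :=
  exists (N : 'M[k]_(3, 6)) (e : 'rV[k]_6) (c : {mpoly k[3]}),
    [/\ row_free (col_mx N e), c \is 2.-homog, nonsingular c &
        forall P, Z P <->
          exists u : 'rV[k]_3, exists2 t : k,
            val P = <[u *m N + t *: e]>%VS & ev c u = 0].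

Section Kummer1.
Variables (k : fieldType) (alpha beta : k).

Let x : {mpoly k[4]} := 'X_(@Ordinal 4 0 isT).
Let y : {mpoly k[4]} := 'X_(@Ordinal 4 1 isT).
Let z : {mpoly k[4]} := 'X_(@Ordinal 4 2 isT).
Let w : {mpoly k[4]} := 'X_(@Ordinal 4 3 isT).

Definition kummer1 : {mpoly k[4]} :=
  beta ^+ 2 *: x ^+ 4 + alpha ^+ 2 *: (x ^+ 2 * z ^+ 2) + x ^+ 2 * z * w
  + x * y * z ^+ 2 + y ^+ 2 * w ^+ 2 + z ^+ 4.

Definition sigma1 : ratmap k := fun i => nth 0
  [:: x * z ^+ 2; y * z ^+ 2; beta *: (x ^+ 2 * z); beta *: (x ^+ 2 * w)] i.

Definition sigma2 : ratmap k := fun i => nth 0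
  [:: x ^+ 2 * z; x ^+ 2 * w; x * z ^+ 2; y * z ^+ 2] i.

End Kummer1.

Lemma delta_neq0 (k : fieldType) n (i : 'I_n) : delta_mx 0 i != 0 :> 'rV[k]_n.
Proof. by apply/rV0Pn; exists i; rewrite mxE !eqxx oner_neq0. Qed.

(* The plane where the i-th coordinate vanishes, e.g. V(x) for i = 0. *)
Definition coord_plane (k : fieldType) (i : 'I_4) : plane k :=
  pt (delta_neq0 k i).

(* Main.v *)
Require Import Defs.
From mathcomp Require Import all_boot all_order all_algebra.
From mathcomp Require Import mpoly ring.

(** F = Q^2 + x z (x w + y z) with Q = beta x^2 + alpha x z + y w + z^2, so x = 0
    and z = 0 are tropes.  In characteristic 2 a line is bitangent iff F
    restricts to a square on it, i.e. iff the coefficients of s^3 t and s t^3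
    vanish.  In Plücker coordinates these are p01 z^2 + p23 x^2 at two spanning
    points, and they vanish iff x = 0 on the line, or z = 0 on the line, or
    p01 = p23 = 0, or p02 = p03 + p12 = 0.  The last two families are the
    smooth quadric p02 p13 = p03 p12 and the cone p01 p23 = p03^2; they contain
    the lines <p, sigma1 p> and <p, sigma2 p> respectively.  Conversely a
    general line of either family meets X in a point where the respective sigma
    is defined and moves along the line, so these lines are dense.  Order and
    class are then counted explicitly. *)

Set Implicit Arguments.
Unset Strict Implicit.
Unset Printing Implicit Defensive.

Import GRing.Theory.
Local Open Scope ring_scope.

Local Notation i0 := (@Ordinal 4 0 isT).
Local Notation i1 := (@Ordinal 4 1 isT).
Local Notation i2 := (@Ordinal 4 2 isT).
Local Notation i3 := (@Ordinal 4 3 isT).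

(** The equations of the two quadrics are incidence conditions. p01 = p23 = 0 says that the line
    meets both skew lines V(x,y) and V(z,w), whence a P^1 x P^1. p02 = 0 says that it meets V(x,z),
    the common line of the two tropes, whose Plücker point is the vertex of the cone. The obstacle
    is density: the closure defining S(sigma) is taken over an arbitrary dense open U of X, so no
    explicit joining line is known to come from U. A form f that vanishes on the joins from U is
    therefore pulled back to P^3, where density makes it vanish on X after multiplication by a form
    rho controlling the bad locus. To pass from X to the whole quadric, a point of X is produced
    over a prescribed general line. This is solvable because in characteristic 2 the quartic
    condition on that point is the square of a quadratic one. The remaining special lines are
    absorbed by the fact that a product of polynomial functions vanishes identically only if a
    factor does. *)

(** * Coordinate vectors and polynomial functions *)

Definition row4 (k : fieldType) (x y z w : k) : 'rV[k]_4 :=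
  \row_i nth 0 [:: x; y; z; w] i.

Definition row6 (k : fieldType) (a b c d e f : k) : 'rV[k]_6 :=
  \row_i nth 0 [:: a; b; c; d; e; f] i.

Lemma row4P (k : fieldType) (v : 'rV[k]_4) :
  exists x y z w, v = row4 x y z w.
Proof.
exists (v 0 i0), (v 0 i1), (v 0 i2), (v 0 i3); apply/rowP => i; rewrite mxE.
by case: i => [[|[|[|[|]]]] //= ?]; congr (v _ _); apply: val_inj.
Qed.

Lemma row4_inj (k : fieldType) (x y z w x' y' z' w' : k) :
  row4 x y z w = row4 x' y' z' w' -> [/\ x = x', y = y', z = z' & w = w'].
Proof.
move/rowP => E; have := (E i0, E i1, E i2, E i3).
by rewrite !mxE /= => -[[[-> ->] ->] ->].
Qed.

Lemma row6_inj (k : fieldType) (a b c d e f a' b' c' d' e' f' : k) :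
  row6 a b c d e f = row6 a' b' c' d' e' f' ->
  [/\ a = a', b = b' & c = c'] /\ [/\ d = d', e = e' & f = f'].
Proof.
move/rowP => E; have := (E (@Ordinal 6 0 isT), E (@Ordinal 6 1 isT),
  E (@Ordinal 6 2 isT), E (@Ordinal 6 3 isT), E (@Ordinal 6 4 isT),
  E (@Ordinal 6 5 isT)).
by rewrite !mxE /= => -[[[[[-> ->] ->] ->] ->] ->].
Qed.

Lemma row4_lin (k : fieldType) (s t x y z w x' y' z' w' : k) :
  s *: row4 x y z w + t *: row4 x' y' z' w' =
  row4 (s * x + t * x') (s * y + t * y') (s * z + t * z') (s * w + t * w').
Proof.
by apply/rowP => -[[|[|[|[|]]]] //= ?]; rewrite !mxE.
Qed.

Lemma row4Z (k : fieldType) (s x y z w : k) :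
  s *: row4 x y z w = row4 (s * x) (s * y) (s * z) (s * w).
Proof. by apply/rowP => -[[|[|[|[|]]]] //= ?]; rewrite !mxE. Qed.

Lemma row6Z (k : fieldType) (s a b c d e f : k) :
  s *: row6 a b c d e f =
  row6 (s * a) (s * b) (s * c) (s * d) (s * e) (s * f).
Proof. by apply/rowP => -[[|[|[|[|[|[|]]]]]] //= ?]; rewrite !mxE. Qed.

Lemma row4_0 (k : fieldType) : row4 0 0 0 0 = 0 :> 'rV[k]_4.
Proof. by apply/rowP => -[[|[|[|[|]]]] //= ?]; rewrite !mxE. Qed.

Lemma row6_0 (k : fieldType) : row6 0 0 0 0 0 0 = 0 :> 'rV[k]_6.
Proof. by apply/rowP => -[[|[|[|[|[|[|]]]]]] //= ?]; rewrite !mxE. Qed.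

Lemma wedgeE (k : fieldType) (x y z w x' y' z' w' : k) :
  wedge (row4 x y z w) (row4 x' y' z' w') =
  row6 (x * y' - y * x') (x * z' - z * x') (x * w' - w * x')
       (y * z' - z * y') (y * w' - w * y') (z * w' - w * z').
Proof.
by apply/rowP => -[[|[|[|[|[|[|]]]]]] //= ?]; rewrite !mxE /= !mxE.
Qed.

Lemma poly_ext (k : closedFieldType) (p q : {poly k}) :
  (forall t, p.[t] = q.[t]) -> p = q.
Proof.
move=> E; apply/eqP; rewrite -subr_eq0; apply/negPn/negP.
case/closed_nonrootP => t; rewrite rootE hornerD hornerN E subrr.
by rewrite eqxx.
Qed.

Lemma horner_mmap (k : fieldType) n (f : {mpoly k[n]}) (h : 'I_n -> {poly k}) t :
  (mmap polyC h f).[t] = f.@[fun i => (h i).[t]].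
Proof.
rewrite mevalE /mmap horner_sum; apply: eq_bigr => m _.
rewrite hornerM hornerC; congr (_ * _); rewrite /mmap1 horner_prod.
by apply: eq_bigr => i _; rewrite horner_exp.
Qed.

Lemma restr_horner (k : fieldType) (F : {mpoly k[4]}) u v t :
  (restr F u v).[t] = ev F (u + t *: v).
Proof.
rewrite /restr horner_mmap /ev; apply: meval_eq => i.
by rewrite hornerD hornerC hornerZ hornerX !mxE mulrC.
Qed.

(** Irreducibility of affine space, by restriction to the line from v to w: there h is a nonzero
    polynomial in one variable, so g restricts to zero. It extends identities proved off a
    hypersurface to all points. *)
Lemma ev_mul_eq0 (k : closedFieldType) n (g h : {mpoly k[n]}) (w : 'rV[k]_n) :
  ev h w != 0 -> (forall v, ev g v * ev h v = 0) -> forall v, ev g v = 0.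
Proof.
move=> hw gh v.
pose P f := mmap polyC (fun i => (v 0 i)%:P + (w 0 i - v 0 i) *: 'X) f.
have PE f t : (P f).[t] = ev f (v + t *: (w - v)).
  rewrite horner_mmap /ev; apply: meval_eq => i.
  by rewrite hornerD hornerC hornerZ hornerX !mxE mulrC.
have: P g * P h = 0 by apply: poly_ext => t; rewrite hornerM !PE gh horner0.
move/eqP; rewrite mulf_eq0 => /orP[] /eqP P0.
  by have := PE g 0; rewrite P0 horner0 scale0r addr0.
have := PE h 1; rewrite P0 horner0 scale1r addrC subrK => /esym/eqP.
by rewrite (negPf hw).
Qed.

Lemma ev_homogZ (k : fieldType) n (f : {mpoly k[n]}) d (c : k) v :
  f \is d.-homog -> ev f (c *: v) = c ^+ d * ev f v.
Proof.
move=> /dhomogP fd; rewrite /ev !mevalE big_distrr /=.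
rewrite big_seq [RHS]big_seq; apply: eq_bigr => m /fd /= dm.
rewrite mulrCA; congr (_ * _).
rewrite -dm mdegE -prodrXr -big_split /=; apply: eq_bigr => i _.
by rewrite !mxE exprMn.
Qed.

Lemma mpolyX_homog (k : fieldType) n (i : 'I_n) :
  ('X_i : {mpoly k[n]}) \is 1.-homog.
Proof. by rewrite dhomogX /= mdeg1. Qed.

Lemma dhomog_comp (k : fieldType) n l (f : {mpoly k[n]}) d e
    (q : n.-tuple {mpoly k[l]}) :
  f \is d.-homog -> (forall i, tnth q i \is e.-homog) ->
  f \mPo q \is (e * d)%N.-homog.
Proof.
move=> /dhomogP fd qe; rewrite comp_mpolyEX big_seq.
apply: rpred_sum => m /fd /= dm; apply: dhomogZ.
rewrite comp_mpolyX -dm mdegE big_distrr /=.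
elim: (index_enum _) => [|i r IH]; first by rewrite !big_nil dhomog1.
by rewrite !big_cons dhomogM // dhomogMn.
Qed.

(** * Lines and points given by spanning vectors *)

Lemma span2P (k : fieldType) n (u v p : 'rV[k]_n) :
  reflect (exists s t, p = s *: u + t *: v) (p \in <<[:: u; v]>>%VS).
Proof.
rewrite span_cons span_seq1; apply: (iffP memv_addP) => [|[s [t ->]]].
  by case=> _ /vlineP[s ->] [_ /vlineP[t ->] ->]; exists s, t.
exists (s *: u); first by rewrite memvZ ?memv_line.
by exists (t *: v) => //; rewrite memvZ ?memv_line.
Qed.

Lemma wedge_lin (k : fieldType) (u v : 'rV[k]_4) s t s' t' :
  wedge (s *: u + t *: v) (s' *: u + t' *: v) = (s * t' - t * s') *: wedge u v.
Proof.
apply/rowP => i; rewrite !mxE; case: nth => c d; rewrite !mxE.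
by ring.
Qed.

Lemma wedge_free (k : fieldType) (u v : 'rV[k]_4) :
  wedge u v != 0 -> free [:: u; v].
Proof.
apply: contraNT; rewrite free_cons span_seq1 seq1_free negb_and !negbK.
case/orP => [/vlineP[c ->]|/eqP ->]; apply/eqP/rowP => i; rewrite !mxE;
by case: nth => a b; rewrite !mxE; ring.
Qed.

Lemma free_coord (k : fieldType) (u v : 'rV[k]_4) s t s' t' :
  free [:: u; v] -> s *: u + t *: v = s' *: u + t' *: v -> s = s' /\ t = t'.
Proof.
move/wedge_neq0 => w0 E.
have {}E : (s - s') *: u + (t - t') *: v = 0.
  by rewrite !scalerBl addrACA -opprD E subrr.
have w0l p : wedge 0 p = 0 :> 'rV[k]_6.
  by apply/rowP => i; rewrite !mxE; case: nth => a b; rewrite !mxE; ring.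
have w0r p : wedge p 0 = 0 :> 'rV[k]_6.
  by apply/rowP => i; rewrite !mxE; case: nth => a b; rewrite !mxE; ring.
have := wedge_lin u v (s - s') (t - t') 0 1; rewrite E w0l mulr1 mulr0 subr0.
have := wedge_lin u v 1 0 (s - s') (t - t'); rewrite E w0r mul1r mul0r subr0.
move=> /esym/eqP + /esym/eqP.
by rewrite !scaler_eq0 (negPf w0) !orbF !subr_eq0 => /eqP -> /eqP ->.
Qed.

(** [free] unfolds to an equation between the dimension of the span and the length of the list, so
    [uv] itself is the dimension proof required by [gr]. *)
Definition mkline (k : fieldType) (u v : 'rV[k]_4) (uv : free [:: u; v]) :
  line k := exist _ <<[:: u; v]>>%VS uv.

Lemma lineP (k : fieldType) (l : line k) :
  exists u v, free [:: u; v] /\ val l = <<[:: u; v]>>%VS.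
Proof.
have B := line_basis l; eexists _, _; split; first exact: (basis_free B).
by rewrite (span_basis B).
Qed.

Lemma line_free (k : fieldType) (l : line k) u v :
  val l = <<[:: u; v]>>%VS -> free [:: u; v].
Proof. by move=> E; rewrite /free -E (eqP (valP l)). Qed.

Lemma line_span (k : fieldType) (l : line k) u v :
  u \in val l -> v \in val l -> free [:: u; v] -> val l = <<[:: u; v]>>%VS.
Proof.
move=> ul vl /eqP uv; apply/esym/eqP; rewrite eqEdim uv (eqP (valP l)) leqnn andbT.
by apply/span_subvP => w; rewrite !inE => /orP[] /eqP ->.
Qed.

Lemma line_complete (k : fieldType) (l : line k) u :
  u != 0 -> u \in val l -> exists v, val l = <<[:: u; v]>>%VS.
Proof.
move=> un ul; have [u0 [v0 [_ E0]]] := lineP l.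
have [v vl vu] : exists2 v, v \in val l & v \notin <[u]>%VS.
  have [u0u|] := boolP (u0 \in <[u]>%VS); last first.
    by exists u0; rewrite // E0 memv_span ?mem_head.
  exists v0; first by rewrite E0 memv_span // !inE eqxx orbT.
  apply/negP => v0u; have : (val l <= <[u]>)%VS.
    by rewrite E0; apply/span_subvP => w; rewrite !inE => /orP[] /eqP ->.
  by move/dimvS; rewrite (eqP (valP l)) dim_vline un.
exists v; apply: line_span => //.
have: free [:: v; u] by rewrite free_cons span_seq1 vu seq1_free.
rewrite (@perm_free _ _ _ [:: u; v]) //.
exact/permPl/(perm_catC [:: v] [:: u]).
Qed.

Lemma projP (k : fieldType) n (p : proj k n) :
  exists2 v, v != 0 & val p = <[v]>%VS.
Proof.
have d1 := eqP (valP p).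
have v0 : vpick (val p) != 0 by rewrite vpick0 -dimv_eq0 d1.
exists (vpick (val p)) => //; apply/esym/eqP.
by rewrite eqEdim dim_vline v0 d1 -memvE memv_pick.
Qed.

Lemma proj_eq (k : fieldType) n (p : proj k n) v :
  v != 0 -> v \in val p -> val p = <[v]>%VS.
Proof.
move=> v0 vp; apply/esym/eqP; rewrite eqEdim -memvE vp dim_vline v0.
by rewrite (eqP (valP p)).
Qed.

(** * Characteristic 2 and quadratic equations *)

Lemma addr_eq_pchar2 (k : fieldType) (two0 : 2%:R = 0 :> k) (a b : k) :
  a + b = 0 -> a = b.
Proof.
move=> ab; have: a + b + b = b by rewrite ab add0r.
by rewrite -addrA -mulr2n -mulr_natl two0 mul0r addr0.
Qed.

Lemma even_eq0_pchar2 (k : fieldType) : 2%:R = 0 :> k ->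
  [/\ 4%:R = 0 :> k, 6%:R = 0 :> k, - 2%:R = 0 :> k & - 4%:R = 0 :> k].
Proof.
by move=> two0; rewrite (natrM _ 2 2) (natrM _ 2 3) two0 !mul0r oppr0.
Qed.

(* [ring] only uses a hypothesis [c = 0] to erase monomials of coefficient
   exactly c, hence the list of even constants, and moving both sides of the
   goal to the left lets all coefficients become even. *)
Ltac ring_pchar2 two0 :=
  apply: (addr_eq_pchar2 two0);
  let h4 := fresh in let h6 := fresh in let m2 := fresh in let m4 := fresh in
  have [h4 h6 m2 m4] := even_eq0_pchar2 two0;
  ring : two0 h4 h6 m2 m4.

Lemma sqrt_closed (k : closedFieldType) (a : k) : exists r, r ^+ 2 = a.
Proof.
have [r E] := @solve_monicpoly k 2 (fun i => if i == 0%N then a else 0) isT.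
by exists r; rewrite E !big_ord_recl big_ord0 /= expr0 mulr1 mul0r !addr0.
Qed.

Lemma quadratic_root (k : closedFieldType) (a b c : k) :
  a != 0 -> exists r, a * r ^+ 2 + b * r + c = 0.
Proof.
move=> a0; have [r E] := @solve_monicpoly k 2
  (fun i => if i == 0%N then - c / a else - b / a) isT.
exists r; rewrite E !big_ord_recl big_ord0 /= expr0 expr1.
by field.
Qed.

(** The zeros of the two factors will be the two tangency points of a bitangent. When a = 0 one
    factor is t, its zero being at infinity. *)
Lemma binary_quadratic_split (k : closedFieldType) (a b c : k) :
  [|| a != 0, b != 0 | c != 0] -> exists c1 d1 c2 d2,
  [/\ (c1 != 0) || (d1 != 0), (c2 != 0) || (d2 != 0) &
      forall s t, a * s ^+ 2 + b * s * t + c * t ^+ 2 =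
                  (c1 * s + d1 * t) * (c2 * s + d2 * t)].
Proof.
have [-> /= bc|a0 _] := eqVneq a 0.
  by exists 0, 1, b, c; split; rewrite ?oner_eq0 ?orbT // => s t; ring.
have [r E] := quadratic_root b c a0.
exists a, (- a * r), 1, (b / a + r); split; rewrite ?a0 ?oner_eq0 // => s t.
move/eqP: E; rewrite addrC addr_eq0 => /eqP ->.
by field.
Qed.

(** * Plane incidence and linear Plücker equations *)

Lemma wedge_basis_change (k : fieldType) (l : line k) u v u' v' :
  val l = <<[:: u; v]>>%VS -> val l = <<[:: u'; v']>>%VS ->
  exists2 c, c != 0 & wedge u' v' = c *: wedge u v.
Proof.
move=> E E'; have w0 := wedge_neq0 (line_free E').
have: wedge u' v' \in <[wedge u v]>%VS.
  by rewrite -(plueckerE E) (plueckerE E') memv_line.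
case/vlineP => c cE; exists c => //; apply: contraNneq w0 => c0.
by rewrite cE c0 scale0r.
Qed.

Lemma line_in_planeE (k : fieldType) (H : plane k) (l : line k) h u v :
  val H = <[h]>%VS -> val l = <<[:: u; v]>>%VS ->
  line_in_plane H l <->
  \sum_i h 0 i * u 0 i = 0 /\ \sum_i h 0 i * v 0 i = 0.
Proof.
move=> HE E; split=> [Hl|[hu hv] g p].
  by split; apply: Hl; rewrite ?HE ?memv_line // E memv_span // !inE eqxx ?orbT.
rewrite HE E => /vlineP[c ->] /span2P[s [t ->]].
rewrite (eq_bigr (fun i => c * s * (h 0 i * u 0 i) + c * t * (h 0 i * v 0 i))).
  by rewrite big_split /= -!big_distrr /= hu hv !mulr0 addr0.
by move=> i _; rewrite !mxE; ring.
Qed.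

Lemma line_in_coord_plane (k : fieldType) (i : 'I_4) (l : line k) u v :
  val l = <<[:: u; v]>>%VS ->
  line_in_plane (coord_plane k i) l <-> u 0 i = 0 /\ v 0 i = 0.
Proof.
have dotE (x : 'rV[k]_4) :
    \sum_j (delta_mx 0 i : 'rV[k]_4) 0 j * x 0 j = x 0 i.
  rewrite (bigD1 i) //= big1 => [|j /negPf ji].
    by rewrite mxE !eqxx mul1r addr0.
  by rewrite mxE ji andbF mul0r.
by move=> /(@line_in_planeE _ (coord_plane k i) _ _ _ _ erefl) ->; rewrite !dotE.
Qed.

Local Notation j0 := (@Ordinal 6 0 isT).
Local Notation j1 := (@Ordinal 6 1 isT).
Local Notation j2 := (@Ordinal 6 2 isT).
Local Notation j3 := (@Ordinal 6 3 isT).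
Local Notation j5 := (@Ordinal 6 5 isT).

Definition on_S1 (k : fieldType) (l : line k) :=
  forall u v, val l = <<[:: u; v]>>%VS ->
  wedge u v 0 j0 = 0 /\ wedge u v 0 j5 = 0.

(** In characteristic 2 the second equation says that the line is isotropic for an alternating form.
    The line V(x,z) satisfies both equations, and p02 = 0 is the tangent hyperplane of the
    Grassmannian at its Plücker point; this makes the section a cone. *)
Definition on_S2 (k : fieldType) (l : line k) :=
  forall u v, val l = <<[:: u; v]>>%VS ->
  wedge u v 0 j1 = 0 /\ wedge u v 0 j2 + wedge u v 0 j3 = 0.

Lemma on_S1E (k : fieldType) (l : line k) u v :
  val l = <<[:: u; v]>>%VS ->
  on_S1 l <-> wedge u v 0 j0 = 0 /\ wedge u v 0 j5 = 0.
Proof.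
move=> E; split=> [|[w0 w5] u' v' /(wedge_basis_change E)[c _ ->]]; first exact.
by rewrite mxE w0 mulr0 mxE w5 mulr0.
Qed.

Lemma on_S2E (k : fieldType) (l : line k) u v :
  val l = <<[:: u; v]>>%VS ->
  on_S2 l <-> wedge u v 0 j1 = 0 /\ wedge u v 0 j2 + wedge u v 0 j3 = 0.
Proof.
move=> E; split=> [|[w1 w23] u' v' /(wedge_basis_change E)[c _ ->]]; first exact.
have Z j : (c *: wedge u v) 0 j = c * wedge u v 0 j by rewrite mxE.
by rewrite !Z w1 -mulrDr w23 !mulr0.
Qed.

(** * Bitangent lines of the Kummer quartic *)

Section Bitangents.
Variables (k : closedFieldType) (two0 : 2%:R = 0 :> k) (alpha beta : k).
Let F := kummer1 alpha beta.

Lemma ev_kummer1 (x y z w : k) : ev F (row4 x y z w) =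
  beta ^+ 2 * x ^+ 4 + alpha ^+ 2 * (x ^+ 2 * z ^+ 2) + x ^+ 2 * z * w
  + x * y * z ^+ 2 + y ^+ 2 * w ^+ 2 + z ^+ 4.
Proof.
by rewrite /F /kummer1 /ev !(mevalD, mevalM, rmorphXn, mevalZ, mevalXU) /= !mxE.
Qed.

(* The derivative of F at u in the direction v, in characteristic 2. *)
Definition tang (u v : 'rV[k]_4) : k :=
  wedge u v 0 j0 * u 0 i2 ^+ 2 + wedge u v 0 j5 * u 0 i0 ^+ 2.

Lemma kummer1_line (u v : 'rV[k]_4) : exists r, forall s t,
  ev F (s *: u + t *: v) =
  ev F u * s ^+ 4 + tang u v * (s ^+ 3 * t) + r * (s ^+ 2 * t ^+ 2)
  + tang v u * (s * t ^+ 3) + ev F v * t ^+ 4.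
Proof.
have [x [y [z [w ->]]]] := row4P u; have [x' [y' [z' [w' ->]]]] := row4P v.
exists (alpha ^+ 2 * (x ^+ 2 * z' ^+ 2 + x' ^+ 2 * z ^+ 2) + y ^+ 2 * w' ^+ 2
  + y' ^+ 2 * w ^+ 2 + x ^+ 2 * z' * w' + x' ^+ 2 * z * w
  + z ^+ 2 * x' * y' + z' ^+ 2 * x * y) => s t.
rewrite row4_lin /tang !wedgeE !ev_kummer1 !mxE /=.
ring_pchar2 two0.
Qed.

(** Squaring is additive and surjective on k, so a form with even exponents only is the square of
    the form with the square roots of its coefficients. *)
Lemma kummer1_line_square (u v : 'rV[k]_4) : tang u v = 0 -> tang v u = 0 ->
  exists a b c, forall s t, ev F (s *: u + t *: v) =
  (a * s ^+ 2 + b * s * t + c * t ^+ 2) ^+ 2.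
Proof.
move=> uv vu; have [r E] := kummer1_line u v.
have [a aE] := sqrt_closed (ev F u); have [b bE] := sqrt_closed r.
have [c cE] := sqrt_closed (ev F v); exists a, b, c => s t.
rewrite E uv vu -aE -bE -cE; ring_pchar2 two0.
Qed.

Lemma restr_kummer1 (u v : 'rV[k]_4) :
  (restr F u v)`_1 = tang u v /\ (restr F u v)`_3 = tang v u.
Proof.
have [r E] := kummer1_line u v.
suff ->: restr F u v = (ev F u)%:P + tang u v *: 'X + r *: 'X^2
    + tang v u *: 'X^3 + ev F v *: 'X^4.
  by rewrite !coefD !coefZ !coefXn !coefX !coefC /= !mulr0 !mulr1 !addr0 !add0r.
apply: poly_ext => t; rewrite restr_horner -[u in LHS]scale1r E.
rewrite !hornerD !hornerZ !hornerXn hornerX hornerC.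
by ring.
Qed.

Lemma coef_dvdXn m (p : {poly k}) i :
  'X^m %| p -> (i < m)%N -> p`_i = 0.
Proof. by case/dvdpP => q -> im; rewrite coefMXn im. Qed.

(** The basis is adapted to the contact points. If they differ, u and v span them, and double
    contact at each kills the linear coefficient there. If they coincide, fourfold contact at u
    kills the coefficients of degree 1 and 3 at once. *)
Lemma bitangent_tang l : bitangent F l -> exists u v,
  [/\ val l = <<[:: u; v]>>%VS, tang u v = 0 & tang v u = 0].
Proof.
have [u0 [v0 [f0 E0]]] := lineP l.
case=> [F0|[a [b [al bl M]]]].
  exists u0, v0; suff r0: restr F u0 v0 = 0.
    by have [<- <-] := restr_kummer1 u0 v0; rewrite r0 !coef0.
  apply: poly_ext => t; rewrite restr_horner horner0 F0 // E0.
  by apply/span2P; exists 1, t; rewrite scale1r.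
have [u un uE] := projP a; have ul : u \in val l.
  by rewrite (subvP al) // uE memv_line.
have [ab|ab] := eqVneq a b.
  have [v E] := line_complete un ul.
  exists u, v; have := M a al u v uE E; rewrite -ab eqxx => X4.
  by have [<- <-] := restr_kummer1 u v; split=> //; apply: coef_dvdXn X4 _.
have [v vn vE] := projP b; have vl : v \in val l.
  by rewrite (subvP bl) // vE memv_line.
have E : val l = <<[:: u; v]>>%VS.
  apply: line_span => //; rewrite free_cons span_seq1 seq1_free vn andbT.
  apply: contra ab => uv; apply/eqP/val_inj; rewrite vE.
  apply: proj_eq => //; rewrite uE.
  case/vlineP: uv => c cE; apply/vlineP; exists c^-1.
  rewrite cE scalerA mulVf ?scale1r //.
  by apply: contraNneq un => c0; rewrite cE c0 scale0r.
have E' : val l = <<[:: v; u]>>%VS.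
  by rewrite E; apply: eq_span => x; rewrite !inE orbC.
exists u, v; have := M a al u v uE E; have := M b bl v u vE E'.
rewrite !eqxx (negPf ab) eq_sym (negPf ab) => X2 X2'.
have [<- _] := restr_kummer1 u v; have [<- _] := restr_kummer1 v u.
split=> //; [exact: coef_dvdXn X2' _|exact: coef_dvdXn X2 _].
Qed.

Lemma dvdXn_linear (a b : k) (e : bool) : (e -> a = 0) ->
  'X^e %| a%:P + b *: 'X.
Proof.
case: e => [/(_ isT) ->|_]; last by rewrite expr0 dvd1p.
by rewrite expr1 add0r -mul_polyC dvdp_mull.
Qed.

Lemma tang_bitangent l u v : val l = <<[:: u; v]>>%VS ->
  tang u v = 0 -> tang v u = 0 -> bitangent F l.
Proof.
move=> E uv vu; have [a [b [c FE]]] := kummer1_line_square uv vu.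
have [/binary_quadratic_split|] := boolP [|| a != 0, b != 0 | c != 0]; last first.
  rewrite !negb_or !negbK => /and3P[/eqP a0 /eqP b0 /eqP c0]; left => w.
  rewrite E => /span2P[s [t ->]]; rewrite FE a0 b0 c0; ring.
case=> c1 [d1 [c2 [d2 [n1 n2 S]]]]; right.
have f := line_free E.
(* The factor e s + g t vanishes at (s, t) = (g, -e), i.e. at the point g u - e v of the line. *)
have nz (e g : k) : (e != 0) || (g != 0) -> g *: u + - e *: v != 0.
  apply: contraTneq => Z; have := @free_coord _ u v g (- e) 0 0 f.
  rewrite Z !scale0r addr0 => /(_ erefl)[-> /eqP]; rewrite oppr_eq0 => /eqP ->.
  by rewrite eqxx.
exists (pt (nz _ _ n1)), (pt (nz _ _ n2)); split.
- by rewrite -memvE E; apply/span2P; exists d1, (- c1).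
- by rewrite -memvE E; apply/span2P; exists d2, (- c2).
move=> p pl u' v' pE E'.
have /span2P[s [t u'E]] : u' \in <<[:: u; v]>>%VS by rewrite -E E' memv_span ?mem_head.
have /span2P[s' [t' v'E]] : v' \in <<[:: u; v]>>%VS.
  by rewrite -E E' memv_span // !inE eqxx orbT.
(* [L e g] is the factor e s + g t along u' + T v'. Its constant term is the value at p = <u'>, so T
   divides it when p is the zero of that factor; the outer square then doubles the multiplicity. *)
pose L (e g : k) : {poly k} := (e * s + g * t)%:P + (e * s' + g * t') *: 'X.
have ->: restr F u' v' = (L c1 d1 * L c2 d2) ^+ 2.
  apply: poly_ext => T; rewrite restr_horner u'E v'E scalerDr !scalerA addrACA.
  rewrite -!scalerDl FE S !(horner_exp, hornerM, hornerD, hornerZ, hornerC, hornerX).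
  by ring.
have LX (e g : k) (n : (e != 0) || (g != 0)) : 'X^(p == pt (nz _ _ n)) %| L e g.
  apply: dvdXn_linear => /eqP pp.
  have : u' \in val p by rewrite pE memv_line.
  rewrite pp => /vlineP[m]; rewrite u'E scalerDr !scalerA.
  by case/(free_coord f) => -> ->; ring.
by rewrite exprMn exprD; apply: dvdp_mul; rewrite mulnC exprM;
  apply: dvdp_exp2r; apply: LX.
Qed.

(** The two equations are linear in p01 and p23 with determinant p02^2, so p02 != 0 leaves only p01
    = p23 = 0. If p02 = 0 they reduce to x z q = x' z' q = 0, and for q != 0 the linearly dependent
    pairs (x, z) and (x', z') must share a vanishing coordinate. *)
Lemma tangP u v : tang u v = 0 /\ tang v u = 0 <->
  [\/ u 0 i0 = 0 /\ v 0 i0 = 0, u 0 i2 = 0 /\ v 0 i2 = 0,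
     wedge u v 0 j0 = 0 /\ wedge u v 0 j5 = 0 |
     wedge u v 0 j1 = 0 /\ wedge u v 0 j2 + wedge u v 0 j3 = 0].
Proof.
have [x [y [z [w ->]]]] := row4P u; have [x' [y' [z' [w' ->]]]] := row4P v.
rewrite /tang !wedgeE !mxE /=.
set p01 := x * y' - y * x'; set p23 := z * w' - w * z'.
set p02 := x * z' - z * x'; set q := x * w' - w * x' + (y * z' - z * y').
pose H := p01 * z ^+ 2 + p23 * x ^+ 2.
pose H' := (x' * y - y' * x) * z' ^+ 2 + (z' * w - w' * z) * x' ^+ 2.
have HE : H = x * z * q + p02 * (y * z + x * w).
  rewrite /H /p01 /p02 /p23 /q; ring_pchar2 two0.
have HE' : H' = x' * z' * q + p02 * (y' * z' + x' * w').
  rewrite /H' /p02 /q; ring_pchar2 two0.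
rewrite -/H -/H'; split=> [[h1 h2]|].
  have e1 : p01 * p02 ^+ 2 = H * x' ^+ 2 + H' * x ^+ 2.
    rewrite /H /H' /p01 /p02 /p23; ring_pchar2 two0.
  have e2 : p23 * p02 ^+ 2 = H * z' ^+ 2 + H' * z ^+ 2.
    rewrite /H /H' /p01 /p02 /p23; ring_pchar2 two0.
  move/eqP: e1; move/eqP: e2.
  rewrite h1 h2 !mul0r addr0 !mulf_eq0 !orbb.
  have [e _ _|_] := eqVneq p02 0; last first.
    by rewrite !orbF => /eqP -> /eqP ->; constructor 3.
  have [q0|q0] := eqVneq q 0; first by constructor 4.
  move: h1 h2 e; rewrite HE HE' => + + e; rewrite e !mul0r !addr0.
  move/eqP; rewrite !mulf_eq0 (negPf q0) orbF => xz.
  move/eqP; rewrite !mulf_eq0 (negPf q0) orbF => xz'.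
  move/eqP: e; rewrite subr_eq0.
  have [x0|x0] := eqVneq x 0; last first.
    move: xz; rewrite (negPf x0) /= => /eqP ->.
    by rewrite mul0r mulf_eq0 (negPf x0) => /eqP ->; constructor 2.
  rewrite x0 mul0r eq_sym mulf_eq0; have [->|x'0] := eqVneq x' 0.
    by constructor 1.
  rewrite orbF => /eqP ->; move: xz'; rewrite (negPf x'0) /= => /eqP ->.
  by constructor 2.
case=> [[x0 x0']|[z0 z0']|[e1 e2]|[e1 e2]].
- by rewrite /H /H' /p01 x0 x0'; split; ring.
- by rewrite /H /H' /p23 z0 z0'; split; ring.
- have -> : H' = - (p01 * z' ^+ 2 + p23 * x' ^+ 2).
    by rewrite /H' /p01 /p23; ring.
  by rewrite /H e1 e2 !mul0r addr0 oppr0.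
- by rewrite HE HE' e1 e2 !mulr0 !mul0r addr0.
Qed.
End Bitangents.

(** * Closed sets and closures of families of joining lines *)

Lemma vanishes_pluecker (k : fieldType) (f : {mpoly k[6]}) d (l : line k) u v :
  f \is d.-homog -> val l = <<[:: u; v]>>%VS -> ev f (wedge u v) = 0 ->
  vanishes f (pluecker l).
Proof.
move=> fd E f0 p; rewrite (plueckerE E) => /vlineP[c ->].
by rewrite (ev_homogZ _ _ fd) f0 mulr0.
Qed.

Lemma zclosed_vanishes (k : fieldType) n (f : {mpoly k[n.+1]}) d :
  f \is d.-homog -> zclosed (vanishes f).
Proof.
move=> fd; exists (eq f); split=> [_ <-|p]; first by exists d.
by split=> [fp _ <-|H]; [exact: fp|exact: H].
Qed.

Lemma open_dense_refl (k : fieldType) n (X : proj k n -> Prop) :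
  open_dense_in X X.
Proof.
split; last by move=> p Xp Z _; apply.
exists (fun=> False); last by move=> p; split=> [Xp|[]]; first split.
(* The empty set is closed as the zero locus of the constant form 1. *)
exists (eq 1); split=> [_ <-|p]; first by exists 0%N; exact: dhomog1.
split=> // /(_ _ erefl 0 (mem0v _)); rewrite /ev meval1 => /eqP.
by rewrite oner_eq0.
Qed.

(** For an upper bound on the closure the single choice U = X is enough, tested against the closed
    set of zeros of f. *)
Lemma Ssurf_vanishes (k : fieldType) (F : {mpoly k[4]}) (s : ratmap k)
    (f : {mpoly k[6]}) d (L : line k) :
  f \is d.-homog -> (forall v, ev f (wedge v (rapply s v)) = 0) ->
  Ssurf (vanishes F) s L -> vanishes f (pluecker L).
Proof.
move=> fd f0 /(_ _ (open_dense_refl _) _ (zclosed_vanishes fd)); apply.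
by move=> _ [l [p _ [v _ vE]] ->]; exact: vanishes_pluecker fd vE (f0 v).
Qed.

(* Density of U is used through the closed set V((f o q) rho): by rho the
   joining lines are defined, with Plücker coordinates q, where rho <> 0. *)
Lemma Ssurf_intro (k : fieldType) (F : {mpoly k[4]}) dF (s : ratmap k)
    (q : 6.-tuple {mpoly k[4]}) dq (rho : {mpoly k[4]}) dr (L : line k) :
  let Q v := \row_i ev (tnth q i) v in
  F \is dF.-homog -> (forall i, tnth q i \is dq.-homog) ->
  rho \is dr.-homog ->
  (forall v, ev rho v != 0 -> Q v != 0 /\
     exists2 c, c != 0 & wedge v (rapply s v) = c *: Q v) ->
  (forall f d, f \is d.-homog ->
     (forall v, v != 0 -> ev F v = 0 -> ev f (Q v) * ev rho v = 0) ->
     vanishes f (pluecker L)) ->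
  Ssurf (vanishes F) s L.
Proof.
move=> Q Fd qd rd rhoP H U [_ Ud] Z [I [Ih ZE]] UZ.
apply/ZE => f fI; have [d fd] := Ih f fI; apply: (H f d fd) => v v0 Fv.
have Xv : vanishes F (pt v0).
  by move=> _ /vlineP[c ->]; rewrite (ev_homogZ _ _ Fd) Fv mulr0.
have gE p : ev ((f \mPo q) * rho) p = ev f (Q p) * ev rho p.
  rewrite /ev mevalM comp_mpoly_meval; congr (_ * _).
  by apply: meval_eq => i; rewrite mxE.
rewrite -gE; apply: (Ud _ Xv _ (zclosed_vanishes (dhomogM (dhomog_comp fd qd) rd)));
  last exact: memv_line.
move=> p Up w wp; rewrite gE.
have [->|/rhoP[Qw [c c0 wE]]] := eqVneq (ev rho w) 0; first by rewrite mulr0.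
have fr : free [:: w; rapply s w].
  by apply: wedge_free; rewrite wE scaler_eq0 negb_or c0.
have w0 : w != 0.
  by apply: contraTneq fr => ->; rewrite free_cons mem0v.
have /UZ/ZE/(_ f fI (Q w)) -> : pl_image
    (fun l => exists2 p, U p & joins s p l) (pluecker (mkline fr)).
- by exists (mkline fr) => //; exists p => //; exists w => //; apply: proj_eq.
- by rewrite mul0r.
rewrite (@plueckerE _ (mkline fr) w (rapply s w)) // wE.
by apply/vlineP; exists c^-1; rewrite scalerA mulVf ?scale1r.
Qed.

Lemma wedge_pluecker (k : fieldType) (u v : 'rV[k]_4) :
  exists a b c d e f, wedge u v = row6 a b c d e f /\ a * f - b * e + c * d = 0.
Proof.
have [x [y [z [w ->]]]] := row4P u; have [x' [y' [z' [w' ->]]]] := row4P v.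
by rewrite wedgeE; do 6!eexists; split; first reflexivity; ring.
Qed.

(** The matrix with rows (a, b) and (c, d) has rank at most 1, hence is the outer product of (x, y)
    and (z, w). This inverts the Segre map and recovers the points (x,y,0,0) and (0,0,z,w) of a line
    from its Plücker coordinates. *)
Lemma rank1_factor (k : fieldType) (a b c d : k) : a * d = b * c ->
  exists x y z w, [/\ a = x * z, b = x * w, c = y * z & d = y * w].
Proof.
have [->|a0 E] := eqVneq a 0.
  rewrite mul0r => /esym/eqP; rewrite mulf_eq0 => /orP[] /eqP ->.
    by exists 0, 1, c, d; split; ring.
  by exists b, d, 0, 1; split; ring.
exists 1, (c / a), a, b; split; rewrite ?mul1r ?divfK //.
by rewrite mulrAC [c * b]mulrC -E mulrAC mulfV ?mul1r.
Qed.

(** * The surfaces of lines joined by the two involutions *)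

Section Surfaces.
Variables (k : closedFieldType) (two0 : 2%:R = 0 :> k) (alpha beta : k).
Hypothesis beta0 : beta != 0.
Let F := kummer1 alpha beta.

Let x : {mpoly k[4]} := 'X_i0.
Let y : {mpoly k[4]} := 'X_i1.
Let z : {mpoly k[4]} := 'X_i2.
Let w : {mpoly k[4]} := 'X_i3.

Definition evE := (mevalD, mevalM, rmorphXn, mevalZ, mevalXU, mevalC).

Lemma kummer1_homog : F \is 4.-homog.
Proof.
have X (i : 'I_4) n : ('X_i : {mpoly k[4]}) ^+ n \is n.-homog.
  by rewrite -[n in n.-homog]mul1n dhomogMn ?mpolyX_homog.
have X1 := @mpolyX_homog k 4.
rewrite /F /kummer1; repeat apply: dhomogD; rewrite ?dhomogZ ?X //.
- exact: (dhomogM (X i0 2) (X i2 2)).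
- exact: (dhomogM (dhomogM (X i0 2) (X1 i2)) (X1 i3)).
- exact: (dhomogM (dhomogM (X1 i0) (X1 i1)) (X i2 2)).
- exact: (dhomogM (X i1 2) (X i3 2)).
Qed.

Lemma sigma1E (a b c d : k) : rapply (sigma1 beta) (row4 a b c d) =
  row4 (a * c ^+ 2) (b * c ^+ 2) (beta * (a ^+ 2 * c)) (beta * (a ^+ 2 * d)).
Proof.
by apply/rowP => -[[|[|[|[|]]]] //= ?]; rewrite !mxE /sigma1 /ev /= !evE !mxE.
Qed.

Lemma sigma2E (a b c d : k) : rapply (sigma2 k) (row4 a b c d) =
  row4 (a ^+ 2 * c) (a ^+ 2 * d) (a * c ^+ 2) (b * c ^+ 2).
Proof.
by apply/rowP => -[[|[|[|[|]]]] //= ?]; rewrite !mxE /sigma2 /ev /= !evE !mxE.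
Qed.

Lemma Ssurf_on_S1 l : Ssurf (vanishes F) (sigma1 beta) l -> on_S1 l.
Proof.
move=> Sl u v E.
have X1 := @mpolyX_homog k 6.
have H j : (forall p, wedge p (rapply (sigma1 beta) p) 0 j = 0) ->
    wedge u v 0 j = 0.
  move=> H0; rewrite -(mevalXU (fun i => wedge u v 0 i) j).
  apply: (Ssurf_vanishes (X1 j) _ Sl); last by rewrite (plueckerE E) memv_line.
  by move=> p; rewrite /ev mevalXU.
split; apply: H => p; have [a [b [c [d ->]]]] := row4P p;
  by rewrite sigma1E wedgeE mxE /=; ring.
Qed.

Lemma Ssurf_on_S2 l : Ssurf (vanishes F) (sigma2 k) l -> on_S2 l.
Proof.
move=> Sl u v E.
have X1 := @mpolyX_homog k 6.
have H f : f \is 1.-homog -> (forall p, ev f (wedge p (rapply (sigma2 k) p)) = 0) ->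
    ev f (wedge u v) = 0.
  move=> fd f0; apply: (Ssurf_vanishes fd f0 Sl).
  by rewrite (plueckerE E) memv_line.
split.
  rewrite -(mevalXU (fun i => wedge u v 0 i) j1); apply: H => [//|p].
  have [a [b [c [d ->]]]] := row4P p.
  by rewrite /ev mevalXU sigma2E wedgeE mxE /=; ring.
rewrite -(mevalXU (fun i => wedge u v 0 i) j2).
rewrite -[X in _ + X](mevalXU (fun i => wedge u v 0 i) j3) -mevalD.
apply: H => [|p]; first by rewrite dhomogD.
have [a [b [c [d ->]]]] := row4P p.
by rewrite /ev mevalD !mevalXU sigma2E wedgeE !mxE /=; ring_pchar2 two0.
Qed.

(* Coordinates of the line joining (x,y,0,0) and (0,0,z,w). *)
Definition q1 : 6.-tuple {mpoly k[4]} :=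
  [tuple 0; x * z; x * w; y * z; y * w; 0].

Lemma ev_q1 a b c d : \row_i ev (tnth q1 i) (row4 a b c d) =
  row6 0 (a * c) (a * d) (b * c) (b * d) 0.
Proof.
by apply/rowP => -[[|[|[|[|[|[|]]]]]] //= ?];
  rewrite !mxE (tnth_nth 0) /ev /= ?meval0 ?evE ?mxE.
Qed.

Lemma q1_homog i : tnth q1 i \is 2.-homog.
Proof.
have M (a b : 'I_4) := dhomogM (mpolyX_homog k a) (mpolyX_homog k b).
by case: i => [[|[|[|[|[|[|]]]]]] //= ?]; rewrite (tnth_nth 0) /= ?rpred0 //; exact: M.
Qed.

(* The line through (x,y,0,0) and (0,0,z,w) meets X in the points
   (x,y,tz,tw) with beta x^2 + kappa t + z^2 t^2 = 0, where kappa^2 = K. *)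
Lemma exists_point_S1 a b c d :
  let K := alpha ^+ 2 * (a ^+ 2 * c ^+ 2) + a ^+ 2 * c * d + a * b * c ^+ 2
           + b ^+ 2 * d ^+ 2 in
  a != 0 -> c != 0 -> K != 0 -> exists t, [/\ t != 0,
    ev F (row4 a b (t * c) (t * d)) = 0 & beta * a ^+ 2 + (t * c) ^+ 2 != 0].
Proof.
move=> K a0 c0 K0; have [r rE] := sqrt_closed K.
have r0 : r != 0 by apply: contraNneq K0 => r0; rewrite -rE r0 expr0n.
have c20 : c ^+ 2 != 0 by rewrite expf_neq0.
have [t tE] := quadratic_root r (beta * a ^+ 2) c20.
have t0 : t != 0.
  apply/eqP => t0; move/eqP: tE; rewrite t0 expr0n !mulr0 !add0r.
  by rewrite mulf_eq0 expf_eq0 /= (negPf beta0) (negPf a0).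
exists t; split=> //.
  have -> : ev F (row4 a b (t * c) (t * d)) =
      beta ^+ 2 * a ^+ 4 + K * t ^+ 2 + (t * c) ^+ 4.
    by rewrite ev_kummer1 /K; ring.
  rewrite -[RHS](expr0n _ 2) -tE -rE; ring_pchar2 two0.
(* This sum is the factor by which the join with the [sigma1]-image differs from [q1]. The quadratic
   equation turns it into - r t, so K != 0 keeps [sigma1] from fixing the point. *)
rewrite (_ : _ + _ = - (r * t)) ?oppr_eq0 ?mulf_neq0 //.
by apply/eqP; rewrite -addr_eq0 -tE; apply/eqP; ring.
Qed.

Lemma on_S1_Ssurf l : on_S1 l -> Ssurf (vanishes F) (sigma1 beta) l.
Proof.
have [u [v [fr E]]] := lineP l => /(_ u v E).
have [p01 [p02 [p03 [p12 [p13 [p23 [wE pl]]]]]]] := wedge_pluecker u v.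
move: pl; rewrite wE !mxE /= => pl [e0 e5]; rewrite e0 e5 in wE pl.
move: pl; rewrite mul0r sub0r => /eqP; rewrite addrC subr_eq0 => /eqP /esym pl.
have [a [b [c [d [e02 e03 e12 e13]]]]] := rank1_factor pl.
apply: (Ssurf_intro (q := q1) (rho := x * z * (beta *: x ^+ 2 + z ^+ 2))
  (dF := 4) (dq := 2) (dr := 4)).
- exact: kummer1_homog.
- exact: q1_homog.
- have X (i : 'I_4) := mpolyX_homog k i.
  apply: (dhomogM (dhomogM (X _) (X _))); rewrite dhomogD ?dhomogZ //;
    exact: (dhomogMn 2 (X _)).
- move=> p; have [a' [b' [c' [d' ->]]]] := row4P p.
  rewrite ev_q1 sigma1E wedgeE /ev !evE !mxE /= => rho0.
  move: (rho0); rewrite !mulf_eq0 !negb_or -!andbA => /and3P[a0 c0 r0].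
  split.
    rewrite -row6_0; apply/eqP => /row6_inj[[_ /eqP]].
    by rewrite mulf_eq0 (negPf a0) (negPf c0).
  by exists (beta * a' ^+ 2 + c' ^+ 2) => //; rewrite row6Z; congr row6; ring_pchar2 two0.
move=> f n fn f0; apply: (vanishes_pluecker fn E).
have fq p : ev f (\row_i ev (tnth q1 i) p) = ev (f \mPo q1) p.
  by rewrite /ev comp_mpoly_meval; apply: meval_eq => i; rewrite mxE.
rewrite wE e02 e03 e12 e13 -ev_q1 fq.
pose K := alpha ^+ 2 *: (x ^+ 2 * z ^+ 2) + x ^+ 2 * z * w + x * y * z ^+ 2
           + y ^+ 2 * w ^+ 2.
(* The last coordinate of the witness is chosen so that K = alpha^2 + (1 - alpha^2) = 1. *)
apply: (@ev_mul_eq0 _ _ _ (x * z * K) (row4 1 0 1 (1 - alpha ^+ 2))) => [|p].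
  rewrite /ev !evE !mxE /= !(expr1n, mulr1, mul1r).
  by rewrite !mul0r !addr0 addrC subrK oner_eq0.
rewrite -fq; have [a' [b' [c' [d' ->]]]] := row4P p.
rewrite [ev (_ * _) _]/ev !evE !mxE /=.
have [->|a0] := eqVneq a' 0; first by rewrite !mul0r mulr0.
have [->|c0] := eqVneq c' 0; first by rewrite mulr0 !mul0r mulr0.
set K' := (X in _ * (a' * c' * X)); have [->|K0] := eqVneq K' 0; first by rewrite !mulr0.
have [t [t0 Ft rho0]] := exists_point_S1 a0 c0 K0.
have nz : row4 a' b' (t * c') (t * d') != 0.
  by rewrite -row4_0; apply/eqP => /row4_inj[/eqP]; rewrite (negPf a0).
have /eqP := f0 _ nz Ft.
rewrite [ev (_ * _) _]/ev !evE !mxE /= !mulf_eq0 (negPf a0) (negPf t0) (negPf c0) /=.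
rewrite (negPf rho0) orbF !ev_q1 => /eqP ft.
(* Passing from (c', d') to (t c', t d') keeps the line and multiplies its coordinates by t;
   homogeneity of f removes the factor. *)
have: t ^+ n * ev f (row6 0 (a' * c') (a' * d') (b' * c') (b' * d') 0) == 0.
  rewrite -(ev_homogZ _ _ fn) row6Z; apply/eqP; rewrite -[RHS]ft.
  by congr (ev f (row6 _ _ _ _ _ _)); ring.
by rewrite mulf_eq0 expf_eq0 (negPf t0) andbF /= => /eqP ->; rewrite mul0r.
Qed.

(** Up to signs, which characteristic 2 ignores, these are the coordinates of the line joining
    (x,y,z,w) to the point (0,x,0,z) of V(x,z). *)
Definition q2 : 6.-tuple {mpoly k[4]} :=
  [tuple x ^+ 2; 0; x * z; x * z; x * w + y * z; z ^+ 2].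

Lemma ev_q2 a b c d : \row_i ev (tnth q2 i) (row4 a b c d) =
  row6 (a ^+ 2) 0 (a * c) (a * c) (a * d + b * c) (c ^+ 2).
Proof.
by apply/rowP => -[[|[|[|[|[|[|]]]]]] //= ?];
  rewrite !mxE (tnth_nth 0) /ev /= ?meval0 ?evE ?mxE.
Qed.

Lemma q2_homog i : tnth q2 i \is 2.-homog.
Proof.
have X (j : 'I_4) := mpolyX_homog k j.
have M a b := dhomogM (X a) (X b).
have X2 a := dhomogMn 2 (X a).
by case: i => [[|[|[|[|[|[|]]]]]] //= ?]; rewrite (tnth_nth 0) /= ?rpred0 //;
  (try apply: rpredD); (exact: M || exact: X2).
Qed.

(* q2 written in terms of x, z and m = xw + yz. *)
Definition q2' : 6.-tuple {mpoly k[4]} :=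
  [tuple x ^+ 2; 0; x * z; x * z; y; z ^+ 2].

Lemma ev_q2' a b c d : \row_i ev (tnth q2' i) (row4 a b c d) =
  row6 (a ^+ 2) 0 (a * c) (a * c) b (c ^+ 2).
Proof.
by apply/rowP => -[[|[|[|[|[|[|]]]]]] //= ?];
  rewrite !mxE (tnth_nth 0) /ev /= ?meval0 ?evE ?mxE.
Qed.

(** The solutions of a d + b c = m are b = s a, d = m/a + s c. On them F = Q^2 + a c m with Q the
    form of the overview, so for r^2 = a c m the equation F = 0 becomes Q + r = 0, a quadratic in s
    with leading coefficient a c. *)
Lemma exists_point_S2 a c m : a != 0 -> c != 0 -> exists b d,
  ev F (row4 a b c d) = 0 /\ a * d + b * c = m.
Proof.
move=> a0 c0; have [r rE] := sqrt_closed (a * c * m).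
have ac0 : a * c != 0 by rewrite mulf_neq0.
have [s sE] := quadratic_root m
  (beta * a ^+ 2 + alpha * (a * c) + c ^+ 2 + r) ac0.
exists (s * a), (m / a + s * c); split; last first.
  rewrite (_ : _ + _ = m + 2%:R * (a * c * s)); last by field.
  by rewrite two0 mul0r addr0.
pose e := m / a; have mE : m = e * a by rewrite /e divfK.
have -> : ev F (row4 a (s * a) c (e + s * c)) =
    (a * c * s ^+ 2 + m * s + (beta * a ^+ 2 + alpha * (a * c) + c ^+ 2 + r)) ^+ 2
    + (r ^+ 2 + a * c * m).
  rewrite ev_kummer1 mE; ring_pchar2 two0.
by rewrite sE rE expr0n add0r -mulr2n -mulr_natl two0 mul0r.
Qed.

Lemma on_S2_Ssurf l : on_S2 l -> Ssurf (vanishes F) (sigma2 k) l.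
Proof.
have [u [v [fr E]]] := lineP l => /(_ u v E).
have [p01 [p02 [p03 [p12 [p13 [p23 [wE pl]]]]]]] := wedge_pluecker u v.
move: pl; rewrite wE !mxE /= => pl [e1 /(addr_eq_pchar2 two0) e23].
rewrite e1 -e23 in wE pl; move: pl; rewrite mul0r subr0 => /(addr_eq_pchar2 two0) pl.
have [a aE] := sqrt_closed p01; have [c cE] := sqrt_closed p23.
(* The Plücker relation gives p03^2 = p01 p23, and square roots are unique in characteristic 2. *)
have acE : a * c = p03.
  apply: (addr_eq_pchar2 two0); apply/eqP.
  have: (a * c + p03) ^+ 2 == 0; last by rewrite expf_eq0.
  apply/eqP; have -> : (a * c + p03) ^+ 2 = a ^+ 2 * c ^+ 2 + p03 * p03.
    ring_pchar2 two0.
  by rewrite aE cE pl -mulr2n -mulr_natl two0 mul0r.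
apply: (Ssurf_intro (q := q2) (rho := x * z * (x * w + y * z))
  (dF := 4) (dq := 2) (dr := 4)).
- exact: kummer1_homog.
- exact: q2_homog.
- have X (i : 'I_4) := mpolyX_homog k i.
  have M i j := dhomogM (X i) (X j).
  by apply: (dhomogM (M _ _)); apply: rpredD; exact: M.
- move=> p; have [a' [b' [c' [d' ->]]]] := row4P p.
  rewrite ev_q2 sigma2E wedgeE /ev !evE !mxE /= => rho0.
  move: (rho0); rewrite !mulf_eq0 !negb_or -!andbA => /and3P[a0 c0 r0].
  split.
    rewrite -row6_0; apply/eqP => /row6_inj[[/eqP]].
    by rewrite expf_eq0 (negPf a0).
  by exists (a' * d' + b' * c') => //; rewrite row6Z; congr row6; ring_pchar2 two0.
move=> f n fn f0; apply: (vanishes_pluecker fn E).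
have fq p : ev f (\row_i ev (tnth q2' i) p) = ev (f \mPo q2') p.
  by rewrite /ev comp_mpoly_meval; apply: meval_eq => i; rewrite mxE.
rewrite wE -acE -aE -cE -(ev_q2' a p13 c 0) fq.
(* In [q2'] the variable y stands for m, so x z y is [rho] expressed in the new coordinates. *)
apply: (@ev_mul_eq0 _ _ _ (x * z * y) (row4 1 1 1 0)) => [|p].
  by rewrite /ev !evE !mxE /= !mulr1 oner_eq0.
rewrite -fq; have [a' [m [c' [d' ->]]]] := row4P p.
rewrite [ev (_ * _) _]/ev !evE !mxE /=.
have [->|a0] := eqVneq a' 0; first by rewrite !mul0r mulr0.
have [->|c0] := eqVneq c' 0; first by rewrite mulr0 !mul0r mulr0.
have [->|m0] := eqVneq m 0; first by rewrite !mulr0.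
have [b [d [Fd mE]]] := exists_point_S2 m a0 c0.
have nz : row4 a' b c' d != 0.
  by rewrite -row4_0; apply/eqP => /row4_inj[/eqP]; rewrite (negPf a0).
have /eqP := f0 _ nz Fd.
rewrite [ev (_ * _) _]/ev !evE !mxE /= mE !mulf_eq0 (negPf a0) (negPf m0) (negPf c0).
by rewrite !orbF ev_q2 ev_q2' mE => /eqP ->; rewrite mul0r.
Qed.
End Surfaces.

(** * Order and class *)

Lemma dot_row4 (k : fieldType) (a b c d x y z w : k) :
  \sum_i row4 a b c d 0 i * row4 x y z w 0 i = a * x + b * y + c * z + d * w.
Proof. by rewrite !big_ord_recl big_ord0 !mxE /= addr0 !addrA. Qed.

Lemma line_sub_eq (k : fieldType) (l m : line k) u v :
  val l = <<[:: u; v]>>%VS -> u \in val m -> v \in val m -> l = m.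
Proof.
move=> E um vm; apply/val_inj; rewrite E.
by rewrite (line_span um vm (line_free E)).
Qed.

(** Density of the locus f != 0 is [ev_mul_eq0]. The hypothesis [ev f 0 = 0] ensures that a vector
    with f != 0 is nonzero, hence represents a point. *)
Lemma generally_neq0 (k : closedFieldType) n (P : proj k n -> Prop)
    (f : {mpoly k[n.+1]}) d w :
  f \is d.-homog -> ev f 0 = 0 -> ev f w != 0 ->
  (forall p v, val p = <[v]>%VS -> ev f v != 0 -> P p) -> generally P.
Proof.
move=> fd f0 fw H; exists (fun p => ~ vanishes f p).
  split=> [|p _ Z [I [_ ZE]] UZ].
    by exists (vanishes f); [exact: zclosed_vanishes fd|move=> p; split=> [|[]]].
  apply/ZE => g gI v _; move: v; apply: (ev_mul_eq0 fw) => v.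
  have [->|fv] := eqVneq (ev f v) 0; first by rewrite mulr0.
  have v0 : v != 0 by apply: contraNneq fv => ->; rewrite f0.
  have /UZ/ZE/(_ g gI) -> : ~ vanishes f (pt v0).
  - by move=> /(_ v (memv_line v)) /eqP; rewrite (negPf fv).
  - by rewrite mul0r.
  - exact: memv_line.
move=> p np; have [v v0 vE] := projP p; apply: (H p v vE).
apply/eqP => fv; apply: np => w'; rewrite vE => /vlineP[c ->].
by rewrite (ev_homogZ _ _ fd) fv mulr0.
Qed.

Section Bidegree.
Variables (k : closedFieldType) (two0 : 2%:R = 0 :> k) (alpha beta : k).
Let F := kummer1 alpha beta.

Lemma bitangentE l : bitangent F l <->
  [\/ line_in_plane (coord_plane k i0) l, line_in_plane (coord_plane k i2) l,
      on_S1 l | on_S2 l].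
Proof.
split=> [/(bitangent_tang two0)[u [v [E uv vu]]]|].
  have /(tangP two0) : tang u v = 0 /\ tang v u = 0 by [].
  case=> ?; [constructor 1|constructor 2|constructor 3|constructor 4].
  - exact/(line_in_coord_plane _ E).
  - exact/(line_in_coord_plane _ E).
  - exact/(on_S1E E).
  - exact/(on_S2E E).
have [u [v [_ E]]] := lineP l => H.
suff /(tangP two0)[uv vu] :
    [\/ u 0 i0 = 0 /\ v 0 i0 = 0, u 0 i2 = 0 /\ v 0 i2 = 0,
     wedge u v 0 j0 = 0 /\ wedge u v 0 j5 = 0 |
     wedge u v 0 j1 = 0 /\ wedge u v 0 j2 + wedge u v 0 j3 = 0].
  exact: (tang_bitangent two0 alpha beta E).
case: H => [/(line_in_coord_plane _ E)|/(line_in_coord_plane _ E)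
           |/(on_S1E E)|/(on_S2E E)] ?;
  [exact: Or41|exact: Or42|exact: Or43|exact: Or44].
Qed.

(** As x != 0, the line is not inside V(x), and its second spanning vector can be taken where it
    meets that plane. *)
Lemma line_through (l : line k) x y z w :
  x != 0 -> row4 x y z w \in val l -> exists b c d,
  val l = <<[:: row4 x y z w; row4 0 b c d]>>%VS /\ row4 0 b c d != 0.
Proof.
move=> x0 ul; have un : row4 x y z w != 0.
  by rewrite -row4_0; apply/eqP => /row4_inj[/eqP]; rewrite (negPf x0).
have [v E] := line_complete un ul; have [a [b [c [d vE]]]] := row4P v.
pose p := - a *: row4 x y z w + x *: v.
have pE : p = row4 0 (x * b - a * y) (x * c - a * z) (x * d - a * w).
  by rewrite /p vE row4_lin; congr row4; ring.
have fr : free [:: row4 x y z w; p].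
  apply: wedge_free; have := wedge_lin (row4 x y z w) v 1 0 (- a) x.
  rewrite scale1r scale0r addr0 -/p => ->; rewrite scaler_eq0 negb_or.
  by rewrite mul1r mul0r subr0 x0 (wedge_neq0 (line_free E)).
exists (x * b - a * y), (x * c - a * z), (x * d - a * w); rewrite -pE; split.
  by apply: line_span => //; rewrite E; apply/span2P; exists (- a), x.
by move: fr; rewrite free_cons => /andP[_]; rewrite seq1_free.
Qed.

(** Off V(x) and V(z) no line of the two beta-planes passes through p. Each quadric contributes one
    line: the transversal through p to V(x,y) and V(z,w), and the line from p to (0,x,0,z). *)
Lemma order_two : generally (fun p : proj k 3 => exists s : seq (line k),
    [/\ uniq s, size s = 2 &
        forall l, l \in s <-> bitangent F l /\ (val p <= val l)%VS]).
Proof.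
apply: (generally_neq0 (f := 'X_i0 * 'X_i2) (d := 2) (w := row4 1 0 1 0)).
- exact: (dhomogM (mpolyX_homog k _) (mpolyX_homog k _)).
- by rewrite /ev mevalM !mevalXU !mxE mul0r.
- by rewrite /ev mevalM !mevalXU !mxE mul1r oner_eq0.
move=> p v; have [x [y [z [w ->]]]] := row4P v => pE.
rewrite /ev mevalM !mevalXU !mxE /= mulf_eq0 negb_or => /andP[x0 z0].
have fr1 : free [:: row4 x y z w; row4 0 0 z w].
  apply: wedge_free; rewrite wedgeE -row6_0; apply/eqP => /row6_inj[[_ /eqP + _] _].
  by rewrite mulr0 subr0 mulf_eq0 (negPf x0) (negPf z0).
have fr2 : free [:: row4 x y z w; row4 0 x 0 z].
  apply: wedge_free; rewrite wedgeE -row6_0; apply/eqP => /row6_inj[[/eqP + _ _] _].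
  by rewrite mulr0 subr0 mulf_eq0 (negPf x0).
pose l1 := mkline fr1; pose l2 := mkline fr2.
have E1 : val l1 = <<[:: row4 x y z w; row4 0 0 z w]>>%VS by [].
have E2 : val l2 = <<[:: row4 x y z w; row4 0 x 0 z]>>%VS by [].
have S1 : on_S1 l1 by apply/(on_S1E E1); rewrite wedgeE !mxE /=; split; ring.
have S2 : on_S2 l2 by apply/(on_S2E E2); rewrite wedgeE !mxE /=; split; ring.
exists [:: l1; l2]; split=> //.
  rewrite /= andbT inE; apply/eqP => l12; move: S1; rewrite l12 => /(on_S1E E2).
  rewrite wedgeE !mxE /= mulr0 subr0 => -[/eqP + _].
  by rewrite mulf_eq0 (negPf x0).
move=> l; rewrite !inE bitangentE pE -memvE; split.
  case/orP => /eqP ->; rewrite ?E1 ?E2 memv_span ?mem_head //; split=> //.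
    by constructor 3.
  by constructor 4.
case=> H vl; have [b [c [d [E n0]]]] := line_through x0 vl.
case: H => [/(line_in_coord_plane _ E)|/(line_in_coord_plane _ E)
           |/(on_S1E E)|/(on_S2E E)]; rewrite ?wedgeE !mxE /=.
- by case=> /eqP; rewrite (negPf x0).
- by case=> /eqP; rewrite (negPf z0).
- rewrite !mulr0 !subr0 => -[/eqP]; rewrite mulf_eq0 (negPf x0) /= => /eqP b0 cd.
  apply/orP; left; apply/eqP/(line_sub_eq E); rewrite E1; apply/span2P.
    by exists 1, 0; rewrite scale1r scale0r addr0.
  exists 0, (c / z); rewrite scale0r add0r row4Z b0 divfK // !mulr0.
  move/eqP: cd; rewrite subr_eq0 => /eqP zd.
  by congr row4; apply: (mulfI z0); rewrite zd; field.
rewrite !mulr0 !subr0 => -[/eqP]; rewrite mulf_eq0 (negPf x0) /= => /eqP c0.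
rewrite c0 mulr0 sub0r => /eqP; rewrite subr_eq0 => /eqP bd.
apply/orP; right; apply/eqP/(line_sub_eq E); rewrite E2; apply/span2P.
  by exists 1, 0; rewrite scale1r scale0r addr0.
exists 0, (b / x); rewrite scale0r add0r row4Z c0 divfK // !mulr0.
by congr row4; apply: (mulfI x0); rewrite bd; field.
Qed.

(** Each of the four components contributes one line: the sections of H by V(x) and by V(z), the
    join of the points where H meets V(z,w) and V(x,y), and a line through the point b where H meets
    V(x,z). *)
Lemma class_four : generally (fun H : plane k => exists s : seq (line k),
    [/\ uniq s, size s = 4 &
        forall l, l \in s <-> bitangent F l /\ line_in_plane H l]).
Proof.
apply: (generally_neq0 (f := 'X_i1 * 'X_i3) (d := 2) (w := row4 0 1 0 1)).
- exact: (dhomogM (mpolyX_homog k _) (mpolyX_homog k _)).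
- by rewrite /ev mevalM !mevalXU !mxE mul0r.
- by rewrite /ev mevalM !mevalXU !mxE mul1r oner_eq0.
move=> H h; have [h0 [h1 [h2 [h3 ->]]]] := row4P h => HE.
rewrite /ev mevalM !mevalXU !mxE /= mulf_eq0 negb_or => /andP[n1 n3].
(* This second coordinate puts e in H; the ratio h3 : h1 of its x and z is the one forced by the
   equations of the cone. *)
pose t := - (h0 * h3 + h2 * h1) / h1.
pose a := row4 0 h2 (- h1) 0; pose b := row4 0 h3 0 (- h1).
pose c := row4 h1 (- h0) 0 0; pose d := row4 0 0 h3 (- h2).
pose e := row4 h3 t h1 0.
have n13 : h1 * h3 != 0 by rewrite mulf_neq0.
have frx : free [:: a; b].
  apply: wedge_free; rewrite wedgeE -row6_0; apply/eqP => /row6_inj[_ [/eqP + _ _]].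
  by rewrite mulr0 mulNr sub0r opprK (negPf n13).
have frz : free [:: c; b].
  apply: wedge_free; rewrite wedgeE -row6_0; apply/eqP => /row6_inj[[/eqP + _ _] _].
  by rewrite mulr0 subr0 (negPf n13).
have fr1 : free [:: c; d].
  apply: wedge_free; rewrite wedgeE -row6_0; apply/eqP => /row6_inj[[_ /eqP + _] _].
  by rewrite mulr0 subr0 (negPf n13).
have fr2 : free [:: e; b].
  apply: wedge_free; rewrite wedgeE -row6_0; apply/eqP => /row6_inj[[/eqP + _ _] _].
  by rewrite mulr0 subr0 mulf_eq0 (negPf n3).
pose lx := mkline frx; pose lz := mkline frz.
pose l1 := mkline fr1; pose l2 := mkline fr2.
have Ex : val lx = <<[:: a; b]>>%VS by [].
have Ez : val lz = <<[:: c; b]>>%VS by [].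
have E1 : val l1 = <<[:: c; d]>>%VS by [].
have E2 : val l2 = <<[:: e; b]>>%VS by [].
have S1 : on_S1 l1 by apply/(on_S1E E1); rewrite wedgeE !mxE /=; split; ring.
have S2 : on_S2 l2.
  by apply/(on_S2E E2); rewrite wedgeE !mxE /=; split; ring_pchar2 two0.
have Vx : line_in_plane (coord_plane k i0) lx.
  by apply/(line_in_coord_plane _ Ex); rewrite !mxE.
have Vz : line_in_plane (coord_plane k i2) lz.
  by apply/(line_in_coord_plane _ Ez); rewrite !mxE.
have notx u v (l : line k) : val l = <<[:: u; v]>>%VS -> u 0 i0 != 0 -> lx != l.
  move=> E u0; apply: contraNneq u0 => lE; move: Vx; rewrite lE.
  by move/(line_in_coord_plane _ E) => [-> _].
have notz u v (l : line k) i : val l = <<[:: u; v]>>%VS ->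
    i \in [:: u; v] -> i 0 i2 != 0 -> lz != l.
  move=> E uv u0; apply: contraNneq u0 => lE; move: Vz; rewrite lE.
  case/(line_in_coord_plane _ E) => p q; move: uv; rewrite !inE.
  by case/orP => /eqP ->; rewrite ?p ?q eqxx.
exists [:: lx; lz; l1; l2]; split=> //.
  have cx : c 0 i0 != 0 by rewrite mxE.
  have ex : e 0 i0 != 0 by rewrite mxE.
  have dz : d 0 i2 != 0 by rewrite mxE.
  have ez : e 0 i2 != 0 by rewrite mxE.
  have d_in : d \in [:: c; d] by rewrite !inE eqxx orbT.
  have -> : uniq [:: lx; lz; l1; l2] =
      [&& lx != lz, lx != l1, lx != l2, lz != l1, lz != l2 & l1 != l2].
    by rewrite /= !inE !negb_or andbT -!andbA.
  apply/and5P; split; [exact: notx Ez cx|exact: notx E1 cx|exact: notx E2 ex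
    |exact: notz E1 d_in dz|apply/andP; split].
    exact: notz E2 (mem_head _ _) ez.
  apply/eqP => l12; move: S2; rewrite -l12 => /(on_S2E E1).
  rewrite wedgeE !mxE /= mulr0 subr0 => -[/eqP + _].
  by rewrite (negPf n13).
have tE : h1 * t = - (h0 * h3 + h2 * h1) by rewrite /t mulrC divfK.
have dots : [/\ \sum_i row4 h0 h1 h2 h3 0 i * a 0 i = 0,
  \sum_i row4 h0 h1 h2 h3 0 i * b 0 i = 0,
  \sum_i row4 h0 h1 h2 h3 0 i * c 0 i = 0,
  \sum_i row4 h0 h1 h2 h3 0 i * d 0 i = 0 &
  \sum_i row4 h0 h1 h2 h3 0 i * e 0 i = 0].
  by split; rewrite dot_row4 ?tE; ring.
have [da db dc dd de] := dots.
move=> l; rewrite !inE bitangentE; split.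
  case/or4P => /eqP ->; (split;
    [|by apply/(line_in_planeE HE); [reflexivity|split]]).
  - by constructor 1.
  - by constructor 2.
  - by constructor 3.
  - by constructor 4.
have [u [v [fr E]]] := lineP l.
have [x [y [z [w uE]]]] := row4P u; have [x' [y' [z' [w' vE]]]] := row4P v.
rewrite uE vE in fr E.
case=> HV /(line_in_planeE HE E); rewrite !dot_row4 => -[hu hv].
have yE : h1 * y = - (h0 * x + h2 * z + h3 * w).
  by apply/eqP; rewrite -addr_eq0 -hu; apply/eqP; ring.
have yE' : h1 * y' = - (h0 * x' + h2 * z' + h3 * w').
  by apply/eqP; rewrite -addr_eq0 -hv; apply/eqP; ring.
case: HV => [/(line_in_coord_plane _ E)|/(line_in_coord_plane _ E)
           |/(on_S1E E)|/(on_S2E E)]; rewrite ?wedgeE !mxE /= => -[P Q].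
- have insub r s q : h1 * r = - (h0 * 0 + h2 * s + h3 * q) -> row4 0 r s q \in val lx.
    move=> R; rewrite Ex; apply/span2P; exists (- s / h1), (- q / h1).
    rewrite row4_lin; congr row4; try by field.
    by apply: (mulfI n1); rewrite R; field.
  apply/or4P; constructor 1; apply/eqP/(line_sub_eq E).
    by rewrite P insub // yE P.
  by rewrite Q insub // yE' Q.
- have insub r s q : h1 * s = - (h0 * r + h2 * 0 + h3 * q) -> row4 r s 0 q \in val lz.
    move=> R; rewrite Ez; apply/span2P; exists (r / h1), (- q / h1).
    rewrite row4_lin; congr row4; try by field.
    by apply: (mulfI n1); rewrite R; field.
  apply/or4P; constructor 2; apply/eqP/(line_sub_eq E).
    by rewrite P insub // yE P.
  by rewrite Q insub // yE' Q.
(* The coordinates of A' u - A v are combinations of p01, p23 and the equations of H, so this vector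
   is zero. By independence of u and v the form h0 x + h1 y vanishes on the line, which with H
   determines it. *)
- pose A := h0 * x + h1 * y; pose A' := h0 * x' + h1 * y'.
  have [A0 A0'] : A' = 0 /\ - A = 0.
    apply: (free_coord (s' := 0) (t' := 0) fr).
    rewrite !row4_lin !mul0r !addr0; congr row4.
    - transitivity (h1 * (x * y' - y * x')); last by rewrite P mulr0.
      by rewrite /A /A'; ring.
    - transitivity (- h0 * (x * y' - y * x')); last by rewrite P mulr0.
      by rewrite /A /A'; ring.
    - transitivity ((h0 * x' + h1 * y' + h2 * z' + h3 * w') * z
        - (h0 * x + h1 * y + h2 * z + h3 * w) * z' - h3 * (z * w' - w * z')).
        by rewrite /A /A'; ring.
      by rewrite hu hv Q mulr0 !mul0r !subr0.
    - transitivity ((h0 * x' + h1 * y' + h2 * z' + h3 * w') * w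
        - (h0 * x + h1 * y + h2 * z + h3 * w) * w' + h2 * (z * w' - w * z')).
        by rewrite /A /A'; ring.
      by rewrite hu hv Q mulr0 !mul0r subr0 addr0.
  have insub r s q m : h0 * r + h1 * s = 0 ->
      h0 * r + h1 * s + h2 * q + h3 * m = 0 -> row4 r s q m \in val l1.
    move=> R; rewrite R add0r => R'.
    rewrite E1; apply/span2P; exists (r / h1), (q / h3).
    move/eqP: R; rewrite addrC addr_eq0 => /eqP R.
    move/eqP: R'; rewrite addrC addr_eq0 => /eqP R'.
    rewrite row4_lin; congr row4; try by field; rewrite ?n1 ?n3.
    - by apply: (mulfI n1); rewrite R; field; rewrite ?n1 ?n3.
    - by apply: (mulfI n3); rewrite R'; field; rewrite ?n1 ?n3.
  move/eqP: A0'; rewrite oppr_eq0 => /eqP A0'.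
  by apply/or4P; constructor 3; apply/eqP/(line_sub_eq E); apply: insub.
(* The same elimination modulo p02, p03 + p12 and the equations of H: the line lies in the second
   plane h1 x = h3 z. *)
- pose D := h1 * x - h3 * z; pose D' := h1 * x' - h3 * z'.
  have [D0 D0'] : D' = 0 /\ - D = 0.
    apply: (free_coord (s' := 0) (t' := 0) fr).
    rewrite !row4_lin !mul0r !addr0; congr row4.
    - transitivity (- h3 * (x * z' - z * x')); last by rewrite P mulr0.
      by rewrite /D /D'; ring.
    - transitivity (h2 * (x * z' - z * x')
        - h3 * (x * w' - w * x' + (y * z' - z * y'))
        - (x * (h0 * x' + h1 * y' + h2 * z' + h3 * w')
           - x' * (h0 * x + h1 * y + h2 * z + h3 * w))).
        by rewrite /D /D'; ring_pchar2 two0.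
      by rewrite hu hv P Q !mulr0 !subr0.
    - transitivity (- h1 * (x * z' - z * x')); last by rewrite P mulr0.
      by rewrite /D /D'; ring.
    - transitivity (h0 * (x * z' - z * x')
        + h1 * (x * w' - w * x' + (y * z' - z * y'))
        + (z * (h0 * x' + h1 * y' + h2 * z' + h3 * w')
           - z' * (h0 * x + h1 * y + h2 * z + h3 * w))).
        by rewrite /D /D'; ring_pchar2 two0.
      by rewrite hu hv P Q !mulr0 subr0 !addr0.
  have insub r s q m : h1 * r - h3 * q = 0 ->
      h1 * s = - (h0 * r + h2 * q + h3 * m) -> row4 r s q m \in val l2.
    move/eqP; rewrite subr_eq0 => /eqP R R'.
    have rE : r = h3 * q / h1 by rewrite -R mulrC mulKf.
    rewrite E2; apply/span2P; exists (q / h1), (- m / h1).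
    rewrite row4_lin; congr row4; try by field.
    - by rewrite rE; field.
    - by apply: (mulfI n1); rewrite R' rE /t; field.
  move/eqP: D0'; rewrite oppr_eq0 => /eqP D0'.
  by apply/or4P; constructor 4; apply/eqP/(line_sub_eq E); apply: insub.
Qed.
End Bidegree.

(** * The two surfaces as quadrics in the Plücker space *)

Definition row3 (k : fieldType) (a b c : k) : 'rV[k]_3 :=
  \row_i nth 0 [:: a; b; c] i.

Lemma row3P (k : fieldType) (v : 'rV[k]_3) : exists a b c, v = row3 a b c.
Proof.
exists (v 0 (@Ordinal 3 0 isT)), (v 0 (@Ordinal 3 1 isT)),
  (v 0 (@Ordinal 3 2 isT)).
apply/rowP => i; rewrite mxE.
by case: i => [[|[|[|]]] //= ?]; congr (v _ _); apply: val_inj.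
Qed.

Lemma row3_0 (k : fieldType) : row3 0 0 0 = 0 :> 'rV[k]_3.
Proof. by apply/rowP => -[[|[|[|]]] //= ?]; rewrite !mxE. Qed.

Lemma mderivXU (k : fieldType) n (i j : 'I_n) :
  ('X_j : {mpoly k[n]})^`M(i) = (j == i)%:R.
Proof.
rewrite mderivX mnm1E; have [->|_] := eqVneq; last by rewrite scale0r.
rewrite scale1r (_ : (_ - _)%MM = 0%MM) ?mpolyX0 //.
by apply/mnmP => l; rewrite mnmE subnn mnm0E.
Qed.

Lemma proj_neq0 (k : fieldType) n (p : proj k n) v : val p = <[v]>%VS -> v != 0.
Proof.
move=> E; apply: contraTneq (valP p) => v0; rewrite E v0 dim_vline eqxx.
by [].
Qed.

Lemma sqrf_eq0_imp (k : fieldType) (a : k) : a ^+ 2 = 0 -> a = 0.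
Proof. by move/eqP; rewrite expf_eq0 => /eqP. Qed.

Section Quadrics.
Variables (k : closedFieldType) (two0 : 2%:R = 0 :> k) (alpha beta : k).
Hypothesis beta0 : beta != 0.
Let F := kummer1 alpha beta.

Lemma pl_image_S1 P : pl_image (Ssurf (vanishes F) (sigma1 beta)) P <->
  exists a b c d, val P = <[row6 0 a b c d 0]>%VS /\ a * d = b * c.
Proof.
split=> [[l /Ssurf_on_S1 S1 ->]|[a [b [c [d [PE ad]]]]]].
  have [u [v [fr E]]] := lineP l.
  have [p01 [p02 [p03 [p12 [p13 [p23 [wE pl]]]]]]] := wedge_pluecker u v.
  move/(on_S1E E): S1; rewrite (plueckerE E) wE !mxE /= => -[e0 e5].
  exists p02, p03, p12, p13; rewrite e0 e5; split=> //.
  by move/eqP: pl; rewrite e0 mul0r sub0r addrC subr_eq0 => /eqP.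
have [x [y [z [w [xz xw yz yw]]]]] := rank1_factor ad.
have wE : wedge (row4 x y 0 0) (row4 0 0 z w) = row6 0 a b c d 0.
  by rewrite wedgeE xz xw yz yw; congr row6; ring.
have fr : free [:: row4 x y 0 0; row4 0 0 z w].
  by apply: wedge_free; rewrite wE (proj_neq0 PE).
have E : val (mkline fr) = <<[:: row4 x y 0 0; row4 0 0 z w]>>%VS by [].
exists (mkline fr); last by apply/val_inj; rewrite (plueckerE E) PE wE.
by apply: on_S1_Ssurf => //; apply/(on_S1E E); rewrite wE !mxE.
Qed.

Lemma pl_image_S2 P : pl_image (Ssurf (vanishes F) (sigma2 k)) P <->
  exists a b c t, val P = <[row6 a 0 b b t c]>%VS /\ a * c = b ^+ 2.
Proof.
split=> [[l /(Ssurf_on_S2 two0) S2 ->]|[a [b [c [t [PE ac]]]]]].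
  have [u [v [fr E]]] := lineP l.
  have [p01 [p02 [p03 [p12 [p13 [p23 [wE pl]]]]]]] := wedge_pluecker u v.
  move/(on_S2E E): S2; rewrite (plueckerE E) wE !mxE /=.
  case=> e1 /(addr_eq_pchar2 two0) e23.
  exists p01, p03, p23, p13; rewrite e1 -e23; split=> //.
  move: pl; rewrite e1 -e23 mul0r subr0.
  by move/(addr_eq_pchar2 two0) ->; rewrite expr2.
have [x xE] := sqrt_closed a; have [z zE] := sqrt_closed c.
have xz : x * z = b.
  apply: (addr_eq_pchar2 two0); apply: sqrf_eq0_imp.
  have -> : (x * z + b) ^+ 2 = x ^+ 2 * z ^+ 2 + b ^+ 2 by ring_pchar2 two0.
  by rewrite xE zE ac -mulr2n -mulr_natl two0 mul0r.
have [u [v wE]] : exists u v, wedge u v = row6 a 0 b b t c.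
  have [x0|x0] := eqVneq x 0; last first.
    exists (row4 x 0 z (t / x)), (row4 0 x 0 z).
    rewrite wedgeE -xE -xz -zE; congr row6; try (by ring_pchar2 two0).
    by rewrite mul0r sub0r divfK //; ring_pchar2 two0.
  have [z0|z0] := eqVneq z 0.
    exists (row4 0 1 0 0), (row4 0 0 0 t).
    by rewrite wedgeE -xE -xz -zE x0 z0; congr row6; ring.
  exists (row4 x (t / z) z 0), (row4 0 x 0 z).
  rewrite wedgeE -xE -xz -zE x0; congr row6; try (by ring_pchar2 two0).
  by rewrite mul0r subr0 divfK.
have fr : free [:: u; v] by apply: wedge_free; rewrite wE (proj_neq0 PE).
have E : val (mkline fr) = <<[:: u; v]>>%VS by [].
exists (mkline fr); last by apply/val_inj; rewrite (plueckerE E) PE wE.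
apply: on_S2_Ssurf => //; apply/(on_S2E E); rewrite wE !mxE /=; split=> //.
by rewrite -mulr2n -mulr_natl two0 mul0r.
Qed.

Lemma S1_smooth_quadric :
  smooth_quadric_surface (pl_image (Ssurf (vanishes F) (sigma1 beta))).
Proof.
(* The rows are the basis vectors of p02, p03, p12, p13; they span the P^3 where p01 = p23 = 0. *)
pose M : 'M[k]_(4, 6) := \matrix_(i, j) (j == i.+1 :> nat)%:R.
have ME a b c d : row4 a b c d *m M = row6 0 a b c d 0.
  apply/rowP => -[[|[|[|[|[|[|]]]]]] //= ?];
  by rewrite !mxE !big_ord_recl big_ord0 !mxE /= ?(mulr0, mulr1, addr0, add0r).
have X := @mpolyX_homog k 4.
exists M, ('X_i0 * 'X_i3 - 'X_i1 * 'X_i2); split.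
- apply: inj_row_free => v; have [a [b [c [d ->]]]] := row4P v.
  rewrite ME -row6_0 => /row6_inj[[_ -> ->] [-> -> _]].
  exact: row4_0.
- by apply: rpredB; apply: (dhomogM (X _) (X _)).
- move=> v; have [a [b [c [d ->]]]] := row4P v => n0 _.
  have D i : ev ('X_i0 * 'X_i3 - 'X_i1 * 'X_i2)^`M(i) (row4 a b c d) =
      (i0 == i)%:R * d + a * (i3 == i)%:R - ((i1 == i)%:R * c + b * (i2 == i)%:R).
    rewrite mderivB !mderivM !mderivXU /ev.
    rewrite mevalB !mevalD !mevalM !mevalXU !mxE /=.
    by rewrite !rmorph_nat.
  have Da : ev ('X_i0 * 'X_i3 - 'X_i1 * 'X_i2)^`M(i3) (row4 a b c d) = a.
    by rewrite D -!val_eqE /=; ring.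
  have Db : ev ('X_i0 * 'X_i3 - 'X_i1 * 'X_i2)^`M(i2) (row4 a b c d) = - b.
    by rewrite D -!val_eqE /=; ring.
  have Dc : ev ('X_i0 * 'X_i3 - 'X_i1 * 'X_i2)^`M(i1) (row4 a b c d) = - c.
    by rewrite D -!val_eqE /=; ring.
  have Dd : ev ('X_i0 * 'X_i3 - 'X_i1 * 'X_i2)^`M(i0) (row4 a b c d) = d.
    by rewrite D -!val_eqE /=; ring.
  have [a0|a0] := eqVneq a 0; last by exists i3; rewrite Da.
  have [b0|b0] := eqVneq b 0; last by exists i2; rewrite Db oppr_eq0.
  have [c0|c0] := eqVneq c 0; last by exists i1; rewrite Dc oppr_eq0.
  exists i0; rewrite Dd; apply: contraNneq n0 => d0.
  by rewrite a0 b0 c0 d0 row4_0.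
move=> P; rewrite pl_image_S1; split=> [[a [b [c [d [PE ad]]]]]|[u]].
  exists (row4 a b c d); first by rewrite ME.
  by rewrite /ev mevalB !mevalM !mevalXU !mxE /= ad subrr.
have [a [b [c [d ->]]]] := row4P u; rewrite ME => PE.
rewrite /ev mevalB !mevalM !mevalXU !mxE /= => /eqP; rewrite subr_eq0 => /eqP ad.
by exists a, b, c, d.
Qed.

Lemma S2_cone : quadric_cone (pl_image (Ssurf (vanishes F) (sigma2 k))).
Proof.
(* The rows are the directions p01, p03 = p12 and p23; the vertex chosen below is the p13
   direction. *)
pose N : 'M[k]_(3, 6) :=
  \matrix_(i, j) (nth [::] [:: [:: 1; 0; 0; 0; 0; 0]; [:: 0; 0; 1; 1; 0; 0];
                              [:: 0; 0; 0; 0; 0; 1]] i)`_j.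
have NE a b c t : row3 a b c *m N + t *: row6 0 0 0 0 1 0 = row6 a 0 b b t c.
  apply/rowP => -[[|[|[|[|[|[|]]]]]] //= ?];
  by rewrite !mxE !big_ord_recl big_ord0 !mxE /= ?(mulr0, mulr1, addr0, add0r).
pose y0 := @Ordinal 3 0 isT; pose y1 := @Ordinal 3 1 isT.
pose y2 := @Ordinal 3 2 isT.
exists N, (row6 0 0 0 0 1 0), ('X_y0 * 'X_y2 - 'X_y1 ^+ 2).
have evc a b c : ev ('X_y0 * 'X_y2 - 'X_y1 ^+ 2) (row3 a b c) = a * c - b ^+ 2.
  by rewrite /ev mevalB mevalM rmorphXn /= !mevalXU !mxE.
split.
- apply: inj_row_free => v; rewrite -[v]hsubmxK mul_row_col.
  have [a [b [c ->]]] := row3P (lsubmx v).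
  rewrite [rsubmx v]mx11_scalar mul_scalar_mx NE -row6_0.
  move/row6_inj => [[-> _ ->] [_ -> ->]].
  by rewrite row3_0 raddf0 row_mx0.
- have X := @mpolyX_homog k 3.
  by apply: rpredB; [exact: (dhomogM (X _) (X _))|exact: (dhomogMn 2 (X _))].
- move=> v; have [a [b [c ->]]] := row3P v => n0; rewrite evc => /eqP.
  have D i : ev ('X_y0 * 'X_y2 - 'X_y1 ^+ 2)^`M(i) (row3 a b c) =
      (y0 == i)%:R * c + a * (y2 == i)%:R - ((y1 == i)%:R * b + b * (y1 == i)%:R).
    rewrite expr2 mderivB !mderivM !mderivXU /ev.
    rewrite mevalB !mevalD !mevalM !mevalXU !mxE /=.
    by rewrite !rmorph_nat.
  have Da : ev ('X_y0 * 'X_y2 - 'X_y1 ^+ 2)^`M(y2) (row3 a b c) = a.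
    by rewrite D -!val_eqE /=; ring.
  have Dc : ev ('X_y0 * 'X_y2 - 'X_y1 ^+ 2)^`M(y0) (row3 a b c) = c.
    by rewrite D -!val_eqE /=; ring.
  (* The partial derivative in the middle variable is -2b = 0 in characteristic 2, so the gradient
     vanishes only at the nucleus (0,1,0), which is off the conic. *)
  have [a0|a0 _] := eqVneq a 0; last by exists y2; rewrite Da.
  have [c0|c0 _] := eqVneq c 0; last by exists y0; rewrite Dc.
  rewrite a0 c0 mul0r sub0r oppr_eq0 expf_eq0 /= => /eqP b0.
  by move: n0; rewrite a0 b0 c0 row3_0 eqxx.
move=> P; rewrite pl_image_S2; split=> [[a [b [c [t [PE ac]]]]]|[u [t]]].
  by exists (row3 a b c), t; rewrite ?NE // evc ac subrr.
have [a [b [c ->]]] := row3P u; rewrite NE evc => PE /eqP.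
by rewrite subr_eq0 => /eqP ac; exists a, b, c, t.
Qed.
End Quadrics.

(** * The trope planes *)

Section Tropes.
Variables (k : closedFieldType) (two0 : 2%:R = 0 :> k) (alpha beta : k).
Hypothesis beta0 : beta != 0.
Let F := kummer1 alpha beta.

Lemma coef1_square (p : {poly k}) : (p ^+ 2)`_1 = 0.
Proof.
by rewrite expr2 coefM !big_ord_recl big_ord0 /= addr0 [X in _ + X]mulrC -mulr2n
  -mulr_natl two0 mul0r.
Qed.

(** The row space of N lies in the kernel of h and has the same dimension 3. *)
Lemma rowspace_hyperplane (N : 'M[k]_(3, 4)) (h v : 'rV[k]_4) :
  row_free N -> h != 0 -> (forall i, \sum_j h 0 j * N i j = 0) ->
  \sum_j h 0 j * v 0 j = 0 -> exists a, v = a *m N.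
Proof.
move=> Nfree h0 hN hv.
have NK : (N <= kermx h^T)%MS.
  apply/sub_kermxP/matrixP => i j; rewrite !mxE -[RHS](hN i).
  by apply: eq_bigr => l _; rewrite !mxE ord1 mulrC.
have vK : (v <= kermx h^T)%MS.
  apply/sub_kermxP/matrixP => i j; rewrite !mxE -[RHS]hv.
  by apply: eq_bigr => l _; rewrite !mxE !ord1 mulrC.
have rh : \rank h^T = 1%N by rewrite mxrank_tr rank_rV h0.
have KN : (kermx h^T <= N)%MS.
  by rewrite -(geq_leqif (mxrank_leqif_sup NK)) mxrank_ker rh (eqP Nfree).
by have /submxP[a ->] := submx_trans vK KN; exists a.
Qed.

Lemma ev_comp_rows (N : 'M[k]_(3, 4)) (a : 'rV[k]_3) :
  ev (comp_mpoly [tuple \sum_(i < 3) N i j *: 'X_i | j < 4] F) a = ev F (a *m N).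
Proof.
rewrite /ev comp_mpoly_meval; apply: meval_eq => j.
rewrite tnth_mktuple mxE raddf_sum /=; apply: eq_bigr => i _.
by rewrite mevalZ mevalXU mulrC.
Qed.

(** F restricts to a square on H, hence on every line of H, and in characteristic 2 a square has no
    linear coefficient. Testing this on chosen vectors of H determines the tropes. *)
Lemma trope_tang H (h u v : 'rV[k]_4) : trope F H -> val H = <[h]>%VS ->
  \sum_j h 0 j * u 0 j = 0 -> \sum_j h 0 j * v 0 j = 0 -> tang u v = 0.
Proof.
case=> N [c [Nfree HN _ _ Fc]] HE hu hv.
have hN i : \sum_j h 0 j * N i j = 0 by apply: HN; rewrite HE memv_line.
have h0 := proj_neq0 HE.
have [a aE] := rowspace_hyperplane Nfree h0 hN hu.
have [b bE] := rowspace_hyperplane Nfree h0 hN hv.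
have [<- _] := restr_kummer1 two0 alpha beta u v.
pose p := mmap polyC (fun i => (a 0 i)%:P + b 0 i *: 'X) c.
suff -> : restr F u v = p ^+ 2 by exact: coef1_square.
apply: poly_ext => t; rewrite restr_horner aE bE scalemxAl -mulmxDl.
rewrite -ev_comp_rows Fc /ev rmorphXn horner_exp horner_mmap /=.
congr (_ ^+ 2); apply: meval_eq => i.
by rewrite hornerD hornerC hornerZ hornerX !mxE mulrC.
Qed.

Lemma tropeP H : trope F H <-> H = coord_plane k i0 \/ H = coord_plane k i2.
Proof.
have two0' : 2%:R = 0 :> {mpoly k[3]}.
  by rewrite -(rmorph_nat (@mpolyC 3 k)) two0 rmorph0.
have sqrD (p q : {mpoly k[3]}) : (p + q) ^+ 2 = p ^+ 2 + q ^+ 2.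
  by rewrite sqrrD -mulr_natl two0' mul0r addr0.
pose y0 := @Ordinal 3 0 isT; pose y1 := @Ordinal 3 1 isT.
pose y2 := @Ordinal 3 2 isT.
have X := @mpolyX_homog k 3.
have compF (N : 'M[k]_(3, 4)) (X0 X1 X2 X3 : {mpoly k[3]}) :
    \sum_(i < 3) N i i0 *: 'X_i = X0 -> \sum_(i < 3) N i i1 *: 'X_i = X1 ->
    \sum_(i < 3) N i i2 *: 'X_i = X2 -> \sum_(i < 3) N i i3 *: 'X_i = X3 ->
    comp_mpoly [tuple \sum_(i < 3) N i j *: 'X_i | j < 4] F =
      beta ^+ 2 *: X0 ^+ 4 + alpha ^+ 2 *: (X0 ^+ 2 * X2 ^+ 2) + X0 ^+ 2 * X2 * X3
      + X0 * X1 * X2 ^+ 2 + X1 ^+ 2 * X3 ^+ 2 + X2 ^+ 4.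
  move=> <- <- <- <-.
  rewrite /F /kummer1 !(comp_mpolyD, comp_mpolyZ, rmorphXn, rmorphM) /=.
  by rewrite !comp_mpolyXU -!tnth_nth !tnth_mktuple.
split=> [T|].
  have [h h0 HE] := projP H; have [a [b [c [d hE]]]] := row4P h.
  have TT x y z w x' y' z' w' : a * x + b * y + c * z + d * w = 0 ->
      a * x' + b * y' + c * z' + d * w' = 0 ->
      (x * y' - y * x') * z ^+ 2 + (z * w' - w * z') * x ^+ 2 = 0.
    move=> P P'; have := @trope_tang H h (row4 x y z w) (row4 x' y' z' w') T HE.
    by rewrite hE !dot_row4 /tang wedgeE !mxE /=; apply.
  have eqH i : h = h 0 i *: delta_mx 0 i -> H = coord_plane k i.
    move=> E; apply/val_inj => /=; apply: proj_eq; first exact: delta_neq0.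
    have hi : h 0 i != 0 by apply: contraNneq h0 => hi; rewrite E hi scale0r.
    rewrite HE; apply/vlineP; exists (h 0 i)^-1.
    by rewrite {2}E scalerA mulVf ?scale1r.
  (* Pairs of vectors of H are fed to [TT]. For b != 0 they give t (d t - b) = 0, false for a
     suitable t; then for d != 0 they give d - b = d = 0; finally c a^2 = 0, which leaves V(x) and
     V(z). *)
  have b0 : b = 0.
    apply/eqP/negPn/negP => b0.
    have /closed_nonrootP[t] : 'X * (d *: 'X - b%:P) != 0 :> {poly k}.
      rewrite mulf_neq0 ?polyX_eq0 //; apply: contraNneq b0 => E.
      have := congr1 (fun p : {poly k} => - p.[0]) E.
      by rewrite !hornerE /= => /eqP; rewrite ?(mulr0, add0r, sub0r, opprK, oppr0).
    rewrite rootE !hornerE /=; apply/negP; rewrite negbK; apply/eqP.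
    rewrite -(TT 1 (- (a + c * t) / b) t 0 0 d 0 (- b)); first by ring.
    - by field.
    - by ring.
  have d0 : d = 0.
    apply/eqP/negPn/negP => d0; move/eqP: (d0); apply.
    rewrite -(TT 1 0 1 (- (a + c) / d) 0 d 0 (- b)); first by rewrite b0; ring.
    - by field.
    - by ring.
  have : c * a ^+ 2 == 0.
    rewrite -(TT c 0 (- a) 0 0 1 0 0); first by apply/eqP; ring.
    - by ring.
    - by rewrite b0; ring.
  rewrite mulf_eq0 expf_eq0 /= => /orP[] /eqP E0; [left|right]; apply: eqH.
    by rewrite hE E0 b0 d0; apply/rowP => -[[|[|[|[|]]]] //= ?];
      rewrite !mxE /= ?(mulr1, mulr0).
  by rewrite hE E0 b0 d0; apply/rowP => -[[|[|[|[|]]]] //= ?];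
      rewrite !mxE /= ?(mulr1, mulr0).
case=> ->.
  pose N : 'M[k]_(3, 4) := \matrix_(i, j) (j == i.+1 :> nat)%:R.
  (* The plane has coordinates (y, z, w), and at x = 0 one has F = (y w + z^2)^2. *)
  exists N, ('X_y0 * 'X_y2 + 'X_y1 ^+ 2); split.
  - apply: inj_row_free => v; have [a [b [c ->]]] := row3P v.
    have -> : row3 a b c *m N = row4 0 a b c.
      apply/rowP => -[[|[|[|[|]]]] //= ?];
      by rewrite !mxE !big_ord_recl big_ord0 !mxE /= ?(mulr0, mulr1, addr0, add0r).
    by rewrite -row4_0 => /row4_inj[_ -> -> ->]; exact: row3_0.
  - move=> h i /vlineP[c ->]; rewrite big1 // => -[[|j] ?] _; rewrite !mxE /=.
      by rewrite mulr0.
    by rewrite mulr0 mul0r.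
  - by apply: rpredD; [exact: (dhomogM (X _) (X _))|exact: (dhomogMn 2 (X _))].
  - apply/eqP => /(congr1 (fun p => ev p (row3 0 1 0))).
    rewrite /ev mevalD mevalM rmorphXn /= !mevalXU meval0 !mxE /=.
    by rewrite mul0r add0r expr1n => /eqP; rewrite oner_eq0.
  rewrite (compF N 0 'X_y0 'X_y1 'X_y2).
  - by rewrite sqrD !expr0n /= !mul0r !scaler0 !add0r; ring.
  - by rewrite !big_ord_recl big_ord0 !mxE /= !scale0r !addr0.
  - by rewrite !big_ord_recl big_ord0 !mxE /= !scale0r scale1r !addr0;
    congr 'X_ _; apply: val_inj.
  - by rewrite !big_ord_recl big_ord0 !mxE /= !scale0r scale1r add0r !addr0;
    congr 'X_ _; apply: val_inj.
  - by rewrite !big_ord_recl big_ord0 !mxE /= !scale0r scale1r !add0r addr0;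
    congr 'X_ _; apply: val_inj.
(* [bump 2] skips the column of z; in the coordinates (x, y, w) of V(z) one has F = (beta x^2 + y
   w)^2. *)
pose N : 'M[k]_(3, 4) := \matrix_(i, j) (j == bump 2 i :> nat)%:R.
exists N, (beta *: 'X_y0 ^+ 2 + 'X_y1 * 'X_y2); split.
- apply: inj_row_free => v; have [a [b [c ->]]] := row3P v.
  have -> : row3 a b c *m N = row4 a b 0 c.
    apply/rowP => -[[|[|[|[|]]]] //= ?];
    by rewrite !mxE !big_ord_recl big_ord0 !mxE /= ?(mulr0, mulr1, addr0, add0r).
  by rewrite -row4_0 => /row4_inj[-> -> _ ->]; exact: row3_0.
- move=> h i /vlineP[c ->]; rewrite big1 // => -[[|[|[|j]]] ?] _;
    rewrite !mxE /= ?mulr0 ?mul0r //.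
  by case: i => [[|[|[|]]] //= ?]; rewrite mulr0.
- apply: rpredD; last exact: (dhomogM (X _) (X _)).
  by apply: dhomogZ; exact: (dhomogMn 2 (X _)).
- apply/eqP => /(congr1 (fun p => ev p (row3 1 0 0))).
  rewrite /ev mevalD mevalM mevalZ rmorphXn /= !mevalXU meval0 !mxE /=.
  by rewrite mul0r addr0 expr1n mulr1 => /eqP; rewrite (negPf beta0).
rewrite (compF N 'X_y0 'X_y1 0 'X_y2).
- rewrite sqrD exprZn !expr0n /= !(mul0r, mulr0) scaler0 !addr0 -exprM.
  by congr (_ + _); rewrite exprMn.
- by rewrite !big_ord_recl big_ord0 !mxE /= !scale0r scale1r !addr0;
    congr 'X_ _; apply: val_inj.
- by rewrite !big_ord_recl big_ord0 !mxE /= !scale0r scale1r add0r !addr0;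
    congr 'X_ _; apply: val_inj.
- by rewrite !big_ord_recl big_ord0 !mxE /= !scale0r !addr0.
- by rewrite !big_ord_recl big_ord0 !mxE /= !scale0r scale1r !add0r addr0;
    congr 'X_ _; apply: val_inj.
Qed.
End Tropes.

Theorem theorem7p1 (k : closedFieldType) (char2 : 2%N \in [pchar k])
    (alpha beta : k) (beta_neq0 : beta != 0) :
  let F := kummer1 alpha beta in
  let Vx := coord_plane k (@Ordinal 4 0 isT) in
  let Vz := coord_plane k (@Ordinal 4 2 isT) in
  let S1 := Ssurf (vanishes F) (sigma1 beta) in
  let S2 := Ssurf (vanishes F) (sigma2 k) in
  has_bidegree (bitangent F) 2 4 /\
  (forall H, trope F H <-> H = Vx \/ H = Vz) /\
  (forall l, bitangent F l <->
     [\/ line_in_plane Vx l, line_in_plane Vz l, S1 l | S2 l]) /\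
  smooth_quadric_surface (pl_image S1) /\
  quadric_cone (pl_image S2).
Proof.
have two0 : 2%:R = 0 :> k := pcharf0 char2.
move=> F Vx Vz S1 S2.
have S1E l : S1 l <-> on_S1 l.
  by split; [exact: Ssurf_on_S1|exact: (on_S1_Ssurf two0)].
have S2E l : S2 l <-> on_S2 l.
  by split; [exact: (Ssurf_on_S2 two0)|exact: (on_S2_Ssurf two0)].
split; first by split; [exact: order_two|exact: class_four].
split; first by move=> H; exact: tropeP.
split; last by split; [exact: S1_smooth_quadric|exact: S2_cone].
move=> l; rewrite (bitangentE two0); split.
  by case=> [?|?|/S1E ?|/S2E ?];
    [constructor 1|constructor 2|constructor 3|constructor 4].
by case=> [?|?|/S1E ?|/S2E ?];
  [constructor 1|constructor 2|constructor 3|constructor 4].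
Qed.
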